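(* Assume that hypotheses (H1)–(H5) listed in the context hold. Let $(\nu,m_A,m_{F_\alpha},m_\eta)$, $\alpha=1,\dots,d$, be a dissipative measure-valued solution to the system $\partial_tA(u)+\partial_\alpha F_\alpha(u)=0$ on $Q=[0,T]\times\mathbb{T}^d$, generated by a sequence of approximate solutions. Let $U\in W^{1,\infty}(Q)$ be a strong solution to this system. Then: (i) the concentration measure of the relative entropy $\eta(u|U)$ is equal to $m_\eta-m_A\cdot G(U)$, and $$m_\eta-m_A\cdot G(U)\ge0;$$ (ii) for each $\alpha=1,\dots,d$, the concentration measure of the relative flux $F_\alpha(u|U)$ is equal to $m_{F_\alpha}-\nabla F_\alpha(U)\nabla A(U)^{-1}m_A$, and it is bounded by the concentration measure of the relative entropy, i.e. there is a constant $C$ such that $$\bigl|m_{F_\alpha}-\nabla F_\alpha(U)\nabla A(U)^{-1}m_A\bigr|\le C\,\bigl(m_\eta-m_A\cdot G(U)\bigr)$$ as measures on $Q$.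
   Context: Setting. $T>0$, $\mathbb{T}^d$ is the $d$-dimensional torus, $Q=[0,T]\times\mathbb{T}^d$; repeated indices $\alpha$ are summed over $1,\dots,d$. $X\subset\mathbb{R}^n$ is an open convex set with closure $\overline X$, and $A,F_\alpha:\overline X\to\mathbb{R}^n$ ($\alpha=1,\dots,d$) are continuous on $\overline X$ and $C^2$ on $X$. The system is $\partial_t A(u)+\partial_\alpha F_\alpha(u)=0$ for $u:Q\to\overline X$. $\nabla A$, $\nabla F_\alpha$ are Jacobian matrices. A strong solution is a function $U\in W^{1,\infty}(Q)$ with values in a compact subset of $X$ satisfying the system a.e. Hypotheses. (H1) $A$ is $C^2$ on $X$, continuous on $\overline X$, and $\nabla A(u)$ is nonsingular for all $u\in X$. (H2) The system has a companion law $\partial_t\eta(u)+\partial_\alpha q_\alpha(u)=0$ with an entropy $\eta:\overline X\to[0,\infty)$ that is $C^2$ on $X$, continuous on $\overline X$, with $\lim_{|u|\to\infty}\eta(u)=\infty$; that is, there is a smooth $G:X\to\mathbb{R}^n$ with $\nabla\eta=G\cdot\nabla A$ and $\nabla q_\alpha=G\cdot\nabla F_\alpha$ on $X$ for $\alpha=1,\dots,d$. (H3) The symmetric matrix $\nabla^2\eta(u)-G(u)\cdot\nabla^2A(u)=\nabla^2\eta(u)-\sum_k G_k(u)\nabla^2A_k(u)$ is positive definite for all $u\in X$. (H4) There is $C>0$ with $|A(u)|\le C\eta(u)$ and $|F_\alpha(u)|\le C\eta(u)$, $\alpha=1,\dots,d$, for $u\in\overline X$. (H5) For $u\in\overline X$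 and $U\in X$ put $\eta(u|U)=\eta(u)-\eta(U)-G(U)\cdot(A(u)-A(U))$ and $F_\alpha(u|U)=F_\alpha(u)-F_\alpha(U)-\nabla F_\alpha(U)\nabla A(U)^{-1}(A(u)-A(U))$. For a strong solution $U$ with values in a compact subset of $X$ there is $C>0$ such that $|F_\alpha(u|U)|\le C\,\eta(u|U)$ for all $u\in\overline X$, all values $U=U(t,x)$, and $\alpha=1,\dots,d$. Dissipative measure-valued solution. $\mathcal{P}(\overline X)$ is the set of probability measures on $\overline X$; $L^\infty_{\rm weak}$ denotes weakly-star measurable, essentially bounded maps; $\mathcal{M}(Q)$ (resp. $\mathcal{M}^+(Q)$) is the space of signed (resp. nonnegative) finite Radon measures on $Q$; $\langle\nu_{t,x},f(\lambda)\rangle=\int f(\lambda)\,d\nu_{t,x}(\lambda)$. A tuple $(\nu,m_A,m_{F_\alpha},m_\eta)$ is a dissipative measure-valued solution with initial data $(\nu_{0,\cdot},m_A^0,m_\eta^0)$ if $\nu\in L^\infty_{\rm weak}((0,T)\times\mathbb{T}^d;\mathcal{P}(\overline X))$, $m_A\in\mathcal{M}(Q)^n$, $m_{F_\alpha}\in\mathcal{M}(Q)^n$ for each $\alpha$, $m_\eta\in\mathcal{M}^+(Q)$, and: (a) for all $\varphi\in C_c^\infty([0,T)\times\mathbb{T}^d)^n$, $$\int_Q\langle\nu_{t,x},A(\lambda)\rangle\cdot\partial_t\varphi\,dxdt+\int_Q\partial_t\varphi\cdot m_A(dxdt)+\int_Q\langle\nu_{t,x},F_\alpha(\lambda)\rangle\cdot\partial_\alpha\varphi\,dxdt+\int_Q\partial_\alpha\varphi\cdot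 m_{F_\alpha}(dxdt)+\int_{\mathbb{T}^d}\langle\nu_{0,x},A(\lambda)\rangle\cdot\varphi(0)\,dx+\int_{\mathbb{T}^d}\varphi(0)\cdot m_A^0(dx)=0;$$ (b) for all nonnegative $\zeta\in C_c^\infty([0,T))$, $$\int_Q\langle\nu_{t,x},\eta(\lambda)\rangle\zeta'(t)\,dxdt+\int_Q\zeta'(t)\,m_\eta(dxdt)+\int_{\mathbb{T}^d}\langle\nu_{0,x},\eta(\lambda)\rangle\zeta(0)\,dx+\int_{\mathbb{T}^d}\zeta(0)\,m_\eta^0(dx)\ge0.$$ Generated by a sequence of approximate solutions. There exist sequences $u^n:Q\to\overline X$, $P_n$, $Q_n$ such that $\partial_tA(u^n)+\partial_\alpha F_\alpha(u^n)=P_n$ and $\partial_t\eta(u^n)+\partial_\alpha q_\alpha(u^n)=Q_n$ in the sense of distributions, $P_n\to0$ and $Q_n\to0$ in distributions, and $f(u^n(t,x))\,dxdt\rightharpoonup^*\langle\nu_{t,x},f(\lambda)\rangle\,dxdt+m_f$ weakly-star in the sense of measures for $f=A,F_\alpha,\eta$. Moreover $\sup_n\|\eta(u^n)\|_{L^\infty(0,T;L^1(\mathbb{T}^d))}<\infty$ (so the concentration measures disintegrate as $m_f(dxdt)=m_f^t(dx)\otimes dt$) and $\nu$ is the classical Young measure generated by $(u^n)$. Concentration measure. For a (possibly vector-valued) function $f(t,x,u)$, the concentration measure of $f$ is the measure $m_f$ on $Q$ such that $f(t,x,u^n(t,x))\,dxdt\rightharpoonup^*\langle\nu_{t,x},f(t,x,\lambda)\rangle\,dxdt+m_f$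 weakly-star in the sense of measures; for the relative quantities, $f(t,x,u)=\eta(u|U(t,x))$ or $f(t,x,u)=F_\alpha(u|U(t,x))$. For a vector measure $m$, $|m|$ denotes its total variation measure. *)

(* Defs.v *)
From HB Require Import structures.
From mathcomp Require Import all_boot all_order all_algebra.
From mathcomp Require Import all_classical all_reals all_analysis.

Set Implicit Arguments.
Unset Strict Implicit.
Unset Printing Implicit Defensive.

Import Order.TTheory GRing.Theory Num.Theory.
Import numFieldNormedType.Exports.

Local Open Scope classical_set_scope.
Local Open Scope ring_scope.

(* The sigma-algebra generated by the coordinates is the Borel one. *)
Definition rV_display : measure_display -> measure_display.
Proof. exact. Qed.

Section rV_measurable.
Context {R : realType} (n : nat).

Definition rV_coord (i : 'I_n) (v : 'rV[R]_n) : R := v ord0 i.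

Let rV_set0 : g_sigma_preimage rV_coord set0.
Proof. exact: sigma_algebra0. Qed.

Let rV_setC A : g_sigma_preimage rV_coord A -> g_sigma_preimage rV_coord (~` A).
Proof. exact: sigma_algebraC. Qed.

Let rV_bigcup (F : (set 'rV[R]_n)^nat) :
  (forall i, g_sigma_preimage rV_coord (F i)) ->
  g_sigma_preimage rV_coord (\bigcup_i F i).
Proof. exact: sigma_algebra_bigcup. Qed.

HB.instance Definition _ := @isMeasurable.Build
  (rV_display default_measure_display) 'rV[R]_n
  (g_sigma_preimage rV_coord) rV_set0 rV_setC rV_bigcup.

Lemma measurable_rV_coord i : measurable_fun [set: 'rV[R]_n] (rV_coord i).
Proof.
move=> _ Y mY; rewrite setTI; apply: sub_sigma_algebra => /=.
rewrite -bigcup_seq/=; exists i => /=; first by rewrite mem_index_enum.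
by exists Y => //; rewrite setTI.
Qed.

Lemma measurable_fun_rV d (T : measurableType d) (f : T -> 'rV[R]_n) :
  (forall i, measurable_fun [set: T] (fun x => f x ord0 i)) ->
  measurable_fun [set: T] f.
Proof.
move=> mf _ Y mY; rewrite setTI.
suff : g_sigma_preimage rV_coord `<=` [set Z | measurable (f @^-1` Z)] by exact.
apply: smallest_sub.
  split=> [|A mA|F mF] /=.
  - by rewrite preimage_set0.
  - by rewrite setTD preimage_setC; exact: measurableC.
  - by rewrite preimage_bigcup; exact: bigcupT_measurable.
move=> Z; rewrite -bigcup_seq/= => -[i _ [B mB <-]] /=.
by rewrite setTI -[X in measurable X]setTI; exact: mf.
Qed.

End rV_measurable.

Section torus_measure.
Context {R : realType}.

(* The library states lebesgue_measure over measurableTypeR R; time_lebesgue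
   is the same set function over R itself. *)
Definition time_lebesgue (A : set R) : \bar R := lebesgue_measure A.

HB.instance Definition _ := isMeasure.Build _ _ _ time_lebesgue
  (measure0 (@lebesgue_measure R)) (measure_ge0 (@lebesgue_measure R))
  (@measure_semi_sigma_additive _ _ _ (@lebesgue_measure R)).
HB.instance Definition _ := @Measure_isSigmaFinite.Build _ _ _
  time_lebesgue (sigma_finiteT (@lebesgue_measure R)).

Definition circle_measure (A : set R) : \bar R := time_lebesgue (A `&` `[0, 1[).

Let circle0 : circle_measure set0 = 0%E.
Proof. by rewrite /circle_measure set0I measure0. Qed.

Let circle_ge0 A : (0 <= circle_measure A)%E.
Proof. exact: measure_ge0. Qed.

Let circle_sigma_additive : semi_sigma_additive circle_measure.
Proof.
exact: (@measure_semi_sigma_additive _ _ _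
  (mrestr time_lebesgue (measurable_itv `[0 : R, 1[))).
Qed.

HB.instance Definition _ := isMeasure.Build _ _ _ circle_measure
  circle0 circle_ge0 circle_sigma_additive.

Let circleT : circle_measure [set: R] = 1%E.
Proof.
by rewrite /circle_measure setTI [LHS]lebesgue_measure_itv/= lte01 sube0.
Qed.

HB.instance Definition _ := Measure_isProbability.Build _ _ _ circle_measure
  circleT.

Definition rV_cons d (p : R * 'rV[R]_d) : 'rV[R]_d.+1 :=
  row_mx (p.1)%:M p.2 : 'rV[R]_(1 + d).

Lemma measurable_rV_cons d : measurable_fun [set: R * 'rV[R]_d] (@rV_cons d).
Proof.
apply: measurable_fun_rV => i.
have [j ->|->] := unliftP ord0 i.
  rewrite (_ : (fun _ => _) = rV_coord j \o snd); last first.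
    apply/funext => -[t v] /=; rewrite /rV_cons.
    rewrite (_ : lift ord0 j = rshift 1 j); last exact/val_inj.
    exact: row_mxEr.
  by apply: measurableT_comp; [exact: measurable_rV_coord|exact: measurable_snd].
rewrite (_ : (fun _ => _) = fst); first exact: measurable_fst.
apply/funext => -[t v] /=; rewrite /rV_cons.
rewrite (_ : ord0 = lshift d (ord0 : 'I_1)); last exact/val_inj.
by apply: etrans (row_mxEl _ _ _ _) _; rewrite mxE.
Qed.

HB.instance Definition _ d := @isMeasurableFun.Build _ _ _ _ (@rV_cons d)
  (@measurable_rV_cons d).

(* T^d = R^d / Z^d: d-fold product of Lebesgue measure on [0, 1[. *)
Fixpoint torus_measure d : probability 'rV[R]_d R :=
  match d with
  | 0 => dirac (0 : 'rV[R]_0)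
  | d'.+1 => distribution (circle_measure \x torus_measure d')%E (@rV_cons d')
  end.

End torus_measure.

Section euclidean.
Context {R : realType}.

Definition dot n (v w : 'rV[R]_n) : R := \sum_i v ord0 i * w ord0 i.

(* The library norm on 'rV[R]_n is the sup norm. *)
Definition enorm n (v : 'rV[R]_n) : R := Num.sqrt (dot v v).

Definition posdef n (M : 'M[R]_n) : Prop :=
  forall v : 'rV[R]_n, v != 0 -> 0 < (v *m M *m v^T) ord0 ord0.

(* C^k on D, which is meant to be open: all iterated directional derivatives
   of order < k are differentiable on D, those of order k continuous. *)
Fixpoint Ck (V W : normedModType R) (k : nat) (D : set V) (f : V -> W) : Prop :=
  match k with
  | 0 => forall x, D x -> {for x, continuous f}
  | k'.+1 => (forall x, D x -> differentiable f x) /\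
             forall v, Ck k' D (fun x => 'D_v f x)
  end.

Definition smooth (V W : normedModType R) (f : V -> W) : Prop :=
  forall k, Ck k [set: V] f.

Definition gradient n (f : 'rV[R]_n -> R) (u : 'rV[R]_n) : 'rV[R]_n :=
  \row_j 'D_(delta_mx ord0 j) f u.

Definition hessian n (f : 'rV[R]_n -> R) (u : 'rV[R]_n) : 'M[R]_n :=
  \matrix_(i, j) 'D_(delta_mx ord0 i) (fun v => 'D_(delta_mx ord0 j) f v) u.

End euclidean.

Section charges.
Context d (S : measurableType d) (R : realType).

Definition charge_integral (m : {charge set S -> \bar R}) (D : set S)
    (f : S -> R) : R :=
  let HP := cid (Hahn_decomposition m) in
  let HN := cid (svalP HP) in
  \int[jordan_pos (svalP HN)]_(x in D) f x -
  \int[jordan_neg (svalP HN)]_(x in D) f x.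

Definition charge_pairing n (m : 'I_n -> {charge set S -> \bar R})
    (D : set S) (f : S -> 'rV[R]_n) : R :=
  \sum_i charge_integral (m i) D (fun x => f x ord0 i).

Definition charge_total_variation n (m : 'I_n -> {charge set S -> \bar R})
    (E : set S) : \bar R :=
  ereal_sup [set (\sum_(0 <= k <oo) (enorm (\row_i fine (m i (P k))))%:E)%E
            | P in [set P : (set S)^nat |
                [/\ forall k, measurable (P k), trivIset [set: nat] P
                  & \bigcup_k P k = E]]].

End charges.

(* Functions on Q = [0, T] x T^d are represented by functions on R x R^d, and
   T^d by its fundamental domain [0, 1[^d: integrals and measures on Q live on
   cylinder T, and a function is continuous (smooth) on Q when its periodic
   lift is so. *)
Section spacetime.
Context {R : realType} (d : nat).

Definition time_dir : R * 'rV[R]_d := (1, 0).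
Definition space_dir (a : 'I_d) : R * 'rV[R]_d := (0, delta_mx ord0 a).

Definition cube : set 'rV[R]_d := [set x | forall i, 0 <= x ord0 i < 1].
Definition cylinder (T : R) : set (R * 'rV[R]_d) := `[0, T] `*` cube.
Definition strip (T : R) : set (R * 'rV[R]_d) := `[0, T] `*` [set: 'rV[R]_d].

Definition volume : {measure set (R * 'rV[R]_d) -> \bar R} :=
  (time_lebesgue \x torus_measure d)%E.

Definition space_periodic (W : Type) (D : set (R * 'rV[R]_d))
    (f : R * 'rV[R]_d -> W) : Prop :=
  forall p a, D p -> f (p + space_dir a) = f p.

Definition continuous_cylinder (T : R) (W : topologicalType)
    (f : R * 'rV[R]_d -> W) : Prop :=
  {within strip T, continuous f} /\ space_periodic (strip T) f.

(* C_c^oo([0, T) x T^d), each function being extended smoothly to t < 0 *)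
Definition test_initial (T : R) (W : normedModType R)
    (phi : R * 'rV[R]_d -> W) : Prop :=
  [/\ smooth phi, space_periodic [set: _] phi
    & exists2 b, b < T & forall t x, b <= t -> phi (t, x) = 0].

(* C_c^oo((0, T) x T^d) *)
Definition test_interior (T : R) (W : normedModType R)
    (phi : R * 'rV[R]_d -> W) : Prop :=
  test_initial T phi /\
  exists2 a, 0 < a & forall t x, t <= a -> phi (t, x) = 0.

(* C_c^oo([0, T)) *)
Definition test_time (T : R) (zeta : R -> R) : Prop :=
  smooth zeta /\ exists2 b, b < T & forall t, b <= t -> zeta t = 0.

Definition Linfty (T : R) (f : R * 'rV[R]_d -> R) : Prop :=
  measurable_fun (cylinder T) f /\
  exists M, {ae volume, forall p, cylinder T p -> `|f p| <= M}.

Definition weak_partial (T : R) (v : R * 'rV[R]_d) (f g : R * 'rV[R]_d -> R) :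
    Prop :=
  forall phi : R * 'rV[R]_d -> R, test_interior T phi ->
    \int[volume]_(p in cylinder T) (f p * 'D_v phi p) =
    - \int[volume]_(p in cylinder T) (g p * phi p).

Definition W1infty (T : R) (f : R * 'rV[R]_d -> R) : Prop :=
  [/\ Linfty T f,
      exists2 g, Linfty T g & weak_partial T time_dir f g
    & forall a, exists2 g, Linfty T g & weak_partial T (space_dir a) f g].

End spacetime.

Arguments cube {R} d _ : assert.
Arguments cylinder {R d} T _ : assert.
Arguments strip {R d} T _ : assert.
Arguments volume {R} d.

Section system.
Context {R : realType} (d n : nat).
Local Notation state := 'rV[R]_n.
Local Notation point := (R * 'rV[R]_d)%type.
Implicit Types (X : set state) (A G : state -> state).
Implicit Types (F : 'I_d -> state -> state).
Implicit Types (eta : state -> R) (q : 'I_d -> state -> R).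
Implicit Types (U : point -> state).

Definition convex_domain X : Prop :=
  convex_set (X : set (convex_lmodType state)).

Definition C2_cont (W : normedModType R) X (f : state -> W) : Prop :=
  {within closure X, continuous f} /\ Ck 2 X f.

(* 'J acts on row vectors, hence is the transpose of the usual Jacobian. *)
Definition nonsingular X A : Prop := forall u, X u -> 'J A u \in unitmx.

Definition coercive X eta : Prop :=
  forall M : R, exists r : R,
    forall u, closure X u -> r <= enorm u -> M <= eta u.

Definition companion_law X A F eta q G : Prop :=
  [/\ forall u, X u -> gradient eta u = G u *m ('J A u)^T,
      forall a u, X u -> differentiable (q a) u
    & forall a u, X u -> gradient (q a) u = G u *m ('J (F a) u)^T].

Definition entropy_law X A F eta q G : Prop :=
  [/\ C2_cont X eta, forall u, closure X u -> 0 <= eta u, coercive X eta,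
      Ck 1 X G & companion_law X A F eta q G].

Definition convex_entropy X A eta G : Prop :=
  forall u, X u ->
    posdef (hessian eta u -
            \sum_k G u ord0 k *: hessian (fun v => A v ord0 k) u).

Definition entropy_growth X A F eta : Prop :=
  exists2 C : R, 0 < C &
    forall u, closure X u ->
      enorm (A u) <= C * eta u /\ forall a, enorm (F a u) <= C * eta u.

Definition relative_entropy A eta G (u v : state) : R :=
  eta u - eta v - dot (G v) (A u - A v).

(* transpose of (nabla F_a)(v) (nabla A)(v)^-1 *)
Definition flux_matrix A F (a : 'I_d) (v : state) : 'M[R]_n :=
  invmx ('J A v) *m 'J (F a) v.

Definition relative_flux A F (a : 'I_d) (u v : state) : state :=
  F a u - F a v - (A u - A v) *m flux_matrix A F a v.

Definition relative_flux_bound (T : R) X A F eta G U : Prop :=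
  exists2 C : R, 0 < C &
    forall u p a, closure X u -> cylinder T p ->
      enorm (relative_flux A F a u (U p)) <= C * relative_entropy A eta G u (U p).

(* U is the continuous representative of its class in W^{1,oo}(Q). *)
Definition strong_solution (T : R) X A F U : Prop :=
  [/\ continuous_cylinder T U,
      forall i, W1infty T (fun p => U p ord0 i),
      exists K, [/\ compact K, K `<=` X & forall p, cylinder T p -> K (U p)]
    & forall i, exists (g : point -> R) (h : 'I_d -> point -> R),
        [/\ Linfty T g /\ (forall a, Linfty T (h a)),
            weak_partial T (time_dir d) (fun p => A (U p) ord0 i) g,
            forall a,
              weak_partial T (space_dir a) (fun p => F a (U p) ord0 i) (h a)
          & {ae volume d, forall p, cylinder T p -> g p + \sum_a h a p = 0}]].

Section measure_valued.
Context disp (S : measurableType disp).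

Definition average X (nu : R.-pker S ~> state) (f : S -> state -> R) (p : S) :
  R := \int[nu p]_(y in closure X) f p y.

Definition average_rV X (nu : R.-pker S ~> state) (f : state -> state) (p : S) :
  state := \row_i average X nu (fun _ y => f y ord0 i) p.

Definition averageable X (mu : {measure set S -> \bar R}) (D : set S)
    (nu : R.-pker S ~> state) (f : S -> state -> R) : Prop :=
  {ae mu, forall p, D p -> (nu p).-integrable (closure X) (EFin \o f p)} /\
  mu.-integrable D (EFin \o average X nu f).

Definition valued_in X (mu : {measure set S -> \bar R}) (D : set S)
    (nu : R.-pker S ~> state) : Prop :=
  {ae mu, forall p, D p -> nu p (closure X) = 1%E}.

End measure_valued.

Definition weak_balance (T : R) X A F (nu : R.-pker point ~> state)
    (mA : 'I_n -> {charge set point -> \bar R})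
    (mF : 'I_d -> 'I_n -> {charge set point -> \bar R})
    (nu0 : R.-pker 'rV[R]_d ~> state)
    (mA0 : 'I_n -> {charge set 'rV[R]_d -> \bar R}) : Prop :=
  forall phi : point -> state, test_initial T phi ->
    \int[volume d]_(p in cylinder T)
       dot (average_rV X nu A p) ('D_(time_dir d) phi p) +
    charge_pairing mA (cylinder T) (fun p => 'D_(time_dir d) phi p) +
    \sum_a (\int[volume d]_(p in cylinder T)
               dot (average_rV X nu (F a) p) ('D_(space_dir a) phi p) +
            charge_pairing (mF a) (cylinder T)
               (fun p => 'D_(space_dir a) phi p)) +
    \int[torus_measure d]_(x in cube d)
       dot (average_rV X nu0 A x) (phi (0, x)) +
    charge_pairing mA0 (cube d) (fun x => phi (0, x)) = 0.

Definition entropy_dissipation (T : R) X eta (nu : R.-pker point ~> state)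
    (m_eta : {finite_measure set point -> \bar R})
    (nu0 : R.-pker 'rV[R]_d ~> state)
    (m_eta0 : {finite_measure set 'rV[R]_d -> \bar R}) : Prop :=
  forall zeta : R -> R, test_time T zeta ->
    (forall t, 0 <= t -> 0 <= zeta t) ->
    0 <= \int[volume d]_(p in cylinder T)
           (average X nu (fun=> eta) p * derive1 zeta p.1) +
         \int[m_eta]_(p in cylinder T) derive1 zeta p.1 +
         \int[torus_measure d]_(x in cube d)
           (average X nu0 (fun=> eta) x * zeta 0) +
         \int[m_eta0]_(x in cube d) zeta 0.

Definition dissipative_mv_solution (T : R) X A F eta
    (nu : R.-pker point ~> state)
    (mA : 'I_n -> {charge set point -> \bar R})
    (mF : 'I_d -> 'I_n -> {charge set point -> \bar R})
    (m_eta : {finite_measure set point -> \bar R})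
    (nu0 : R.-pker 'rV[R]_d ~> state)
    (mA0 : 'I_n -> {charge set 'rV[R]_d -> \bar R})
    (m_eta0 : {finite_measure set 'rV[R]_d -> \bar R}) : Prop :=
  [/\ valued_in X (volume d) (cylinder T) nu /\
        valued_in X (torus_measure d) (cube d) nu0,
      [/\ forall i, averageable X (volume d) (cylinder T) nu
                      (fun _ y => A y ord0 i),
          forall a i, averageable X (volume d) (cylinder T) nu
                      (fun _ y => F a y ord0 i)
        & averageable X (volume d) (cylinder T) nu (fun=> eta)],
      (forall i, averageable X (torus_measure d) (cube d) nu0
                      (fun _ y => A y ord0 i)) /\
        averageable X (torus_measure d) (cube d) nu0 (fun=> eta),
      weak_balance T X A F nu mA mF nu0 mA0
    & entropy_dissipation T X eta nu m_eta nu0 m_eta0].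

(* f(t, x, u^k(t, x)) dxdt converges to <nu, f(t, x, .)> dxdt + m weakly-star
   in the dual of C(Q) *)
Definition concentration (T : R) X (u : nat -> point -> state)
    (nu : R.-pker point ~> state) (f : point -> state -> R)
    (m : {charge set point -> \bar R}) : Prop :=
  [/\ forall k, (volume d).-integrable (cylinder T) (fun p => (f p (u k p))%:E),
      averageable X (volume d) (cylinder T) nu f
    & forall phi : point -> R, continuous_cylinder T phi ->
        \int[volume d]_(p in cylinder T) (phi p * f p (u k p)) @[k --> \oo] -->
        \int[volume d]_(p in cylinder T) (phi p * average X nu f p) +
        charge_integral m (cylinder T) phi].

Definition young_measure (T : R) X (u : nat -> point -> state)
    (nu : R.-pker point ~> state) : Prop :=
  forall g : state -> R, {within closure X, continuous g} ->
    (forall e : R, 0 < e -> exists r : R,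
       forall y, closure X y -> r <= enorm y -> `|g y| <= e) ->
    forall psi : point -> R,
      (volume d).-integrable (cylinder T) (EFin \o psi) ->
      \int[volume d]_(p in cylinder T) (psi p * g (u k p)) @[k --> \oo] -->
      \int[volume d]_(p in cylinder T) (psi p * average X nu (fun=> g) p).

(* The residuals P k, S k are distributions on (0, T) x T^d, seen as
   functionals on test functions. *)
Definition approximate_solutions (T : R) X A F eta q
    (u : nat -> point -> state) (P : nat -> (point -> state) -> R)
    (S : nat -> (point -> R) -> R) : Prop :=
  [/\ forall k, measurable_fun (cylinder T) (u k) /\
                forall p, cylinder T p -> closure X (u k p),
      forall a k, (volume d).-integrable (cylinder T)
                    (fun p => (q a (u k p))%:E),
      forall k (phi : point -> state), test_interior T phi ->
        P k phi = - \int[volume d]_(p in cylinder T)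
          (dot (A (u k p)) ('D_(time_dir d) phi p) +
           \sum_a dot (F a (u k p)) ('D_(space_dir a) phi p)),
      forall k (phi : point -> R), test_interior T phi ->
        S k phi = - \int[volume d]_(p in cylinder T)
          (eta (u k p) * 'D_(time_dir d) phi p +
           \sum_a q a (u k p) * 'D_(space_dir a) phi p)
    & (forall phi : point -> state, test_interior T phi ->
         P k phi @[k --> \oo] --> (0 : R)) /\
      (forall phi : point -> R, test_interior T phi ->
         S k phi @[k --> \oo] --> (0 : R))].

Definition generated_by (T : R) X A F eta q
    (nu : R.-pker point ~> state)
    (mA : 'I_n -> {charge set point -> \bar R})
    (mF : 'I_d -> 'I_n -> {charge set point -> \bar R})
    (m_eta : {finite_measure set point -> \bar R})
    (u : nat -> point -> state) (P : nat -> (point -> state) -> R)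
    (S : nat -> (point -> R) -> R) : Prop :=
  [/\ approximate_solutions T X A F eta q u P S,
      [/\ forall i, concentration T X u nu (fun _ y => A y ord0 i) (mA i),
          forall a i, concentration T X u nu (fun _ y => F a y ord0 i) (mF a i)
        & concentration T X u nu (fun=> eta) (charge_of_finite_measure m_eta)],
      exists M : R, forall k,
        {ae time_lebesgue, forall t, 0 <= t <= T ->
          (\int[torus_measure d]_(x in cube d) (eta (u k (t, x)))%:E <= M%:E)%E}
    & young_measure T X u nu].

End system.

(* Main.v *)
Require Import Defs.
From HB Require Import structures.
From mathcomp Require Import all_boot all_order all_algebra.
From mathcomp Require Import all_classical all_reals all_analysis.
From mathcomp Require Import measurable_realfun.
From mathcomp Require Import ring lra.
Set Implicit Arguments.
Unset Strict Implicit.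
Unset Printing Implicit Defensive.
Import Order.TTheory GRing.Theory Num.Theory.
Import numFieldNormedType.Exports.
Local Open Scope classical_set_scope.
Local Open Scope ring_scope.

(** At a fixed space-time point, the relative entropy and every component of the
relative flux are linear combinations of 1, eta, the components of A and
those of F_a evaluated at the state variable.  The coefficients depend on the
point only, through U; as U is continuous, periodic in space, and takes its
values in a compact part of X, where G, the Jacobian matrices and the inverse
of the Jacobian of A are continuous, the coefficients are continuous on the
space-time torus.  A test function multiplied by a coefficient is again a test
function, so concentration measures combine with the same coefficients
([concentration_lincomb]); this gives the two formulas.

The inequalities come from one principle: if such a combination f is
nonnegative for all states in the closure of X, then so is its concentration
measure.  Indeed f dominates its truncations to bounded sets of states, the
truncations do not concentrate because the Young measure describes their
limits completely, and their averages increase to the average of f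
([defect_ge0]).  This yields nonnegativity against test functions, and then on
measurable sets, whose indicators are limits in the mean of periodic
continuous functions ([charge_ge0_cylinder]).

The relative entropy is nonnegative because it dominates the norm of a
relative flux, up to a positive constant C.  For the bound on the relative
flux, let x be the value of its concentration measure on a set E.  By the
Cauchy-Schwarz inequality, C |x| times the relative entropy minus the scalar
product of x with the relative flux is nonnegative; so is its concentration
measure, whose value on E is C |x| m_rel(E) - |x|^2, m_rel being the
concentration measure of the relative entropy.  Hence |x| <= C m_rel(E), and
summing over the pieces of a partition bounds the total variation. *)

(** * Integrals of real-valued functions *)

Section real_integrals.
Context disp (S : measurableType disp) (R : realType).
Variables (mu : {measure set S -> \bar R}) (D : set S) (mD : measurable D).

Lemma integrable_Rsum (I : Type) (r : seq I) (P : pred I) (f : I -> S -> R) :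
  (forall i, mu.-integrable D (EFin \o f i)) ->
  mu.-integrable D (fun x => (\sum_(i <- r | P i) f i x)%:E).
Proof.
move=> f_int.
have := @integrable_sum _ _ _ mu D mD I r P _ (fun i _ => f_int i).
by apply: eq_integrable => // x _; rewrite /= sumEFin.
Qed.

Lemma Rintegral_sum (I : Type) (r : seq I) (P : pred I) (f : I -> S -> R) :
  (forall i, mu.-integrable D (EFin \o f i)) ->
  \int[mu]_(x in D) (\sum_(i <- r | P i) f i x) =
  \sum_(i <- r | P i) \int[mu]_(x in D) f i x.
Proof.
move=> f_int; elim: r => [|i r ih].
  under eq_Rintegral do rewrite big_nil.
  by rewrite big_nil Rintegral_cst// mul0r.
under eq_Rintegral do rewrite big_cons.
rewrite big_cons; case: (P i) => //; rewrite RintegralD//; first by rewrite ih.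
exact: integrable_Rsum.
Qed.

Lemma bounded_sum (I : Type) (r : seq I) (P : pred I) (f : I -> S -> R) :
  (forall i, [bounded f i x | x in D]) ->
  [bounded \sum_(i <- r | P i) f i x | x in D].
Proof.
move=> bf; elim: r => [|i r [M [Mr sM]]].
  by exists 0; split => // M M0 x _; rewrite /= big_nil normr0 ltW.
have [N [Nr fN]] := bf i; exists (`|M| + `|N| + 2); split => // K MK x Dx.
rewrite /= big_cons; case: (P i); last first.
  by apply: (sM _ _ x Dx); have := ler_norm M; have := normr_ge0 N; lra.
have := sM (`|M| + 1) _ x Dx; have := fN (`|N| + 1) _ x Dx => /=.
have := ler_norm M; have := ler_norm N => hN hM.
move=> /(_ ltac:(lra)) h1 /(_ ltac:(lra)) h2.
by rewrite (le_trans (ler_normD _ _))//; lra.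
Qed.

Lemma bounded_mul (f g : S -> R) : [bounded f x | x in D] ->
  [bounded g x | x in D] -> [bounded f x * g x | x in D].
Proof.
move=> [M [Mr fM]] [N [Nr gN]]; exists ((`|M| + 1) * (`|N| + 1)); split;
  first exact: num_real.
move=> K MNK x Dx /=; rewrite normrM (le_trans _ (ltW MNK))//.
have := fM (`|M| + 1) _ x Dx; have := gN (`|N| + 1) _ x Dx => /=.
have := ler_norm M; have := ler_norm N => hN hM.
move=> /(_ ltac:(lra)) h1 /(_ ltac:(lra)) h2.
by rewrite ler_pM.
Qed.

(** Measurability of [f] is a separate hypothesis because [mu] may be
    incomplete. *)
Lemma ae_integrable (f g : S -> R) : measurable_fun D f ->
  mu.-integrable D (EFin \o g) ->
  {ae mu, forall x, D x -> f x = g x} -> mu.-integrable D (EFin \o f).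
Proof.
move=> mf ig fg; have mg : measurable_fun D g.
  by apply/measurable_EFinP; exact: measurable_int ig.
apply/integrableP; split; first exact/measurable_EFinP.
move/integrableP : ig => [_]; congr (_ < _)%E; apply: ae_eq_integral => //.
- by apply: measurableT_comp => //; exact/measurable_EFinP.
- by apply: measurableT_comp => //; exact/measurable_EFinP.
- by apply: filterS fg => x fg Dx /=; rewrite fg.
Qed.

Lemma ae_eq_Rintegral (f g : S -> R) : measurable_fun D f ->
  measurable_fun D g ->
  {ae mu, forall x, D x -> f x = g x} ->
  \int[mu]_(x in D) f x = \int[mu]_(x in D) g x.
Proof.
move=> mf mg fg; rewrite /Rintegral; congr fine; apply: ae_eq_integral => //.
- exact/measurable_EFinP.
- exact/measurable_EFinP.
- by apply: filterS fg => x fg Dx /=; rewrite fg.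
Qed.

Lemma Rintegral_dominated_cvg (f_ : nat -> S -> R) (f h : S -> R) :
  (forall n, measurable_fun D (f_ n)) -> measurable_fun D f ->
  {ae mu, forall x, D x -> f_ n x @[n --> \oo] --> f x} ->
  mu.-integrable D (EFin \o h) ->
  {ae mu, forall x n, D x -> `|f_ n x| <= h x} ->
  \int[mu]_(x in D) f_ n x @[n --> \oo] --> \int[mu]_(x in D) f x.
Proof.
move=> mf_ mf cf ih fh; apply: fine_cvg.
have [||||| i _ cv] := @dominated_convergence _ _ R mu D mD
  (fun n x => (f_ n x)%:E) (fun x => (f x)%:E) (EFin \o h).
- by move=> n; exact/measurable_EFinP.
- exact/measurable_EFinP.
- apply: filterS cf => x cf Dx; apply/fine_cvgP; split; last exact: cf.
  exact: nearW.
- exact: ih.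
- by apply: filterS fh => x + n Dx => /(_ n Dx); rewrite lee_fin.
by rewrite fineK//; exact: integrable_fin_num.
Qed.

End real_integrals.

(** * Charges and their densities *)

Section densities.
Context disp (S : measurableType disp) (R : realType).
Implicit Types (D E : set S) (h g : S -> R).

Lemma integrable_bounded_mul (mu : {measure set S -> \bar R}) D h g :
  measurable D -> measurable_fun D h -> [bounded h x | x in D] ->
  mu.-integrable D (EFin \o g) -> mu.-integrable D (fun x => (h x * g x)%:E).
Proof.
move=> mD mh bh ig; have := integrableMr mD mh bh ig.
by apply: eq_integrable => // x _; rewrite /= EFinM.
Qed.

(** Since [lam] is the measure of density [g], its Radon-Nikodym derivative
    agrees with [g] almost everywhere. *)
Lemma Rintegral_finite_density (lam mu : {finite_measure set S -> \bar R}) g :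
  mu.-integrable setT (EFin \o g) ->
  (forall E, measurable E -> lam E = \int[mu]_(x in E) (g x)%:E)%E ->
  forall D h, measurable D -> measurable_fun D h -> [bounded h x | x in D] ->
  \int[lam]_(x in D) h x = \int[mu]_(x in D) (h x * g x).
Proof.
move=> ig lamE D h mD mh bh; rewrite /Rintegral; congr fine.
have /measurable_EFinP mg := measurable_int _ ig.
have lammu : lam `<< mu.
  apply/null_content_dominatesP => A mA muA0; rewrite lamE//.
  by apply: null_set_integral => //; exact/measurable_EFinP/measurable_funTS.
have ih : lam.-integrable D (EFin \o h).
  apply: measurable_bounded_integrable => //;
    first by rewrite ltey_eq fin_num_measure.
rewrite -(Radon_Nikodym_change_of_variables lammu mD ih).
have mRN : measurable_fun D (Radon_Nikodym (charge_of_finite_measure lam) mu).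
  by apply: measurable_funTS; apply: measurable_int;
    apply: Radon_Nikodym_integrable.
have /measurable_EFinP mh' := mh.
under [RHS]eq_integral do rewrite EFinM.
apply: ae_eq_integral => //.
- exact: emeasurable_funM.
- by apply: emeasurable_funM => //; exact/measurable_EFinP/measurable_funTS.
apply: ae_eqe_mul2l; apply: integral_ae_eq => //.
- by apply: (integrableS measurableT) => //; apply: Radon_Nikodym_integrable.
- exact/measurable_EFinP/measurable_funTS.
- by move=> E _ mE; rewrite -Radon_Nikodym_integral// -lamE.
Qed.

(** If [g] is a density of [m], then the Jordan parts of [m] have the densities
    1_P g and - 1_N g, whose difference is g because P and N partition the
    space. *)
Lemma Rintegral_jordan_density (m : {charge set S -> \bar R}) P N
    (PN : hahn_decomposition m P N) (mu : {finite_measure set S -> \bar R}) g :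
  mu.-integrable setT (EFin \o g) ->
  (forall E, measurable E -> m E = \int[mu]_(x in E) (g x)%:E)%E ->
  forall D h, measurable D -> measurable_fun D h -> [bounded h x | x in D] ->
  \int[jordan_pos PN]_(x in D) h x - \int[jordan_neg PN]_(x in D) h x =
  \int[mu]_(x in D) (h x * g x).
Proof.
move=> ig mE D h mD mh bh.
have [[mP _] [mN _] PNT PN_0] := PN.
have dens A : measurable A -> mu.-integrable setT (EFin \o (\1_A * g)).
  move=> mA; apply: (@integrable_bounded_mul mu setT (\1_A) g) => //.
  exists 1; split=> // r r1 x _; apply: le_trans (ltW r1); rewrite /= indicE.
  by case: (_ \in _); rewrite ?normr1 ?normr0.
have resE A E : measurable A -> measurable E ->
    (\int[mu]_(x in E) ((\1_A * g) x)%:E = m (E `&` A))%E.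
  move=> mA mE'; rewrite mE; last exact: measurableI.
  rewrite integral_mkcondr; apply: eq_integral => x _.
  by rewrite patchE /= fctE indicE; case: ifPn => xA; rewrite ?mul1r ?mul0r.
have posE E : measurable E -> jordan_pos PN E = m (E `&` P).
  by move=> mE'; rewrite jordan_posE cjordan_posE /crestr0 mem_set.
have negE E : measurable E -> jordan_neg PN E = (- m (E `&` N))%E.
  by move=> mE'; rewrite jordan_negE cjordan_negE /crestr0 mem_set.
have densN : mu.-integrable setT (EFin \o (fun x => - (\1_N * g) x)).
  by have := integrableN (dens _ mN); exact: eq_integrable.
have -> : \int[jordan_pos PN]_(x in D) h x =
    \int[mu]_(x in D) (h x * (\1_P * g) x).
  apply: Rintegral_finite_density => //; first exact: dens.
  by move=> E mE'; rewrite resE//; exact: posE.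
have -> : \int[jordan_neg PN]_(x in D) h x =
    \int[mu]_(x in D) (h x * - (\1_N * g) x).
  apply: Rintegral_finite_density => // E mE'.
  apply: etrans (negE _ mE') _; rewrite -resE// -integralN//=.
  apply: integrable_add_def => //; apply: (integrableS measurableT) => //.
  exact: dens.
rewrite -RintegralB//; first last.
- by apply: integrable_bounded_mul => //; apply: (integrableS measurableT).
- apply: integrable_bounded_mul => //; apply: (integrableS measurableT) => //.
  exact: dens.
apply: eq_Rintegral => x _; rewrite !fctE -mulrBr opprK -mulrDl; congr (_ * _).
rewrite !indicE; have : (P `|` N) x by rewrite PNT.
have : ~ (P `&` N) x by rewrite PN_0.
have [/set_mem xP|/negP xP] := boolP (x \in P);
  have [/set_mem xN|/negP xN] := boolP (x \in N).
- by move=> /(_ (conj xP xN)).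
- by rewrite addr0 mul1r.
- by rewrite add0r mul1r.
- by rewrite inE in xP; rewrite inE in xN; move=> _ [].
Qed.

(** Replaces the integral against a charge, which is defined by means of some
    Hahn decomposition, by a single integral against a positive measure; this
    makes it linear in the integrand. *)
Lemma charge_integral_density (m : {charge set S -> \bar R})
    (mu : {finite_measure set S -> \bar R}) g :
  mu.-integrable setT (EFin \o g) ->
  (forall E, measurable E -> m E = \int[mu]_(x in E) (g x)%:E)%E ->
  forall D h, measurable D -> measurable_fun D h -> [bounded h x | x in D] ->
  charge_integral m D h = \int[mu]_(x in D) (h x * g x).
Proof.
by move=> ig mE D h mD mh bh; exact: Rintegral_jordan_density.
Qed.

(** The sum of the variations of the charges dominates each of them. *)
Lemma exists_dominating_measure (J : finType)
    (m : J -> {charge set S -> \bar R}) :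
  exists mu : {finite_measure set S -> \bar R}, forall j, m j `<< mu.
Proof.
suff [mu mP] : exists mu : {finite_measure set S -> \bar R},
    forall j, j \in enum J -> m j `<< mu.
  by exists mu => j; apply: mP; rewrite mem_enum.
elim: (enum J) => [|j s [mu mus]]; first by exists mzero.
have [P [N PN]] := Hahn_decomposition (m j).
pose nu : {measure set S -> \bar R} :=
  msum (fun k => if k is 0 then mu : {measure set S -> \bar R}
                 else charge_variation PN) 2.
have nuE A : nu A = (mu A + charge_variation PN A)%E by exact: measure_addE.
have finm : fin_num_fun nu.
  move=> A mA; rewrite nuE fin_numD fin_num_measure//=.
  by rewrite fin_numD !fin_num_measure.
pose finM := @Measure_isFinite.Build _ _ _ _ finm.
pose mu' : {finite_measure set S -> \bar R} :=
  HB.pack (Measure.sort nu) finM.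
exists mu' => k; rewrite inE => /predU1P[->|ks].
  apply/(null_charge_dominatesP PN) => A mA /=.
  rewrite nuE => /eqP.
  by rewrite padde_eq0// => /andP[_ /eqP].
apply/null_content_dominatesP => A mA /=; rewrite nuE => /eqP.
rewrite padde_eq0// => /andP[/eqP muA0 _].
by have /null_content_dominatesP := mus _ ks; apply.
Qed.

(** A common reference measure turns combinations of charges with variable
    coefficients into combinations of functions. *)
Lemma charges_have_densities (J : finType) (m : J -> {charge set S -> \bar R}) :
  exists (mu : {finite_measure set S -> \bar R}) (g : J -> S -> R),
    forall j, mu.-integrable setT (EFin \o g j) /\
      forall E, measurable E -> m j E = (\int[mu]_(x in E) (g j x)%:E)%E.
Proof.
have [mu mus] := exists_dominating_measure m.
exists mu, (fun j => fine \o Radon_Nikodym (m j) mu) => j.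
have fineE : EFin \o (fine \o Radon_Nikodym (m j) mu) = Radon_Nikodym (m j) mu.
  by apply/funext => x /=; rewrite fineK//; exact: Radon_Nikodym_fin_num.
split; first by rewrite fineE; exact: Radon_Nikodym_integrable.
move=> E mE; rewrite (Radon_Nikodym_integral (mus j) mE).
by apply: eq_integral => x _; rewrite -[in LHS]fineE.
Qed.

Lemma charge_of_density (mu : {finite_measure set S -> \bar R}) g :
  mu.-integrable setT (EFin \o g) ->
  exists m : {charge set S -> \bar R},
    forall E, measurable E -> m E = (\int[mu]_(x in E) (g x)%:E)%E.
Proof. by move=> ig; exists (induced_charge ig). Qed.

End densities.

Section charge_integral_linearity.
Context disp (S : measurableType disp) (R : realType).
Variables (m : {charge set S -> \bar R}) (D : set S) (mD : measurable D).

Lemma charge_integralE :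
  exists (mu : {finite_measure set S -> \bar R}) (g : S -> R),
  mu.-integrable D (EFin \o g) /\
  forall h : S -> R, measurable_fun D h -> [bounded h x | x in D] ->
    charge_integral m D h = \int[mu]_(x in D) (h x * g x).
Proof.
have [mu [g gP]] := charges_have_densities (fun _ : unit => m).
have [ig mE] := gP tt; exists mu, (g tt); split.
  exact: integrableS ig.
by move=> h mh bh; exact: charge_integral_density.
Qed.

Lemma charge_integral_lincomb (I : finType) (c : I -> R) (h : I -> S -> R) :
  (forall i, measurable_fun D (h i)) -> (forall i, [bounded h i x | x in D]) ->
  charge_integral m D (fun x => \sum_i c i * h i x) =
  \sum_i c i * charge_integral m D (h i).
Proof.
move=> mh bh; have [mu [g [ig miE]]] := charge_integralE.
have bch i : [bounded c i * h i x | x in D].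
  by apply: bounded_mul => //; exact: bounded_cst.
have mch i : measurable_fun D (fun x => c i * h i x).
  exact: measurable_funM.
rewrite miE; [|exact: measurable_sum|exact: bounded_sum].
under eq_Rintegral do rewrite mulr_suml.
rewrite Rintegral_sum//; last by move=> i; exact: integrable_bounded_mul.
apply: eq_bigr => i _; rewrite miE// -RintegralZl//; last first.
  exact: integrable_bounded_mul.
by apply: eq_Rintegral => x _; rewrite mulrA.
Qed.

End charge_integral_linearity.

(** * Borel sets of states and of space-time points *)

Section spacetime_regularity.
Context {R : realType} (d : nat).
Local Notation point := (R * 'rV[R]_d)%type.

Let rbox (c : rat * 'rV[rat]_d * nat) : set point :=
  [set p : point | `|p.1 - ratr c.1.1| < c.2.+1%:R^-1 /\
           forall i, `|p.2 ord0 i - ratr (c.1.2 ord0 i)| < c.2.+1%:R^-1].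

Let measurable_rbox c : measurable (rbox c).
Proof.
rewrite [X in measurable X](_ : _ = fst @^-1` ball (ratr c.1.1 : R) c.2.+1%:R^-1
  `&` \bigcap_i ((fun p : point => p.2 ord0 i) @^-1`
      ball (ratr (c.1.2 ord0 i) : R) c.2.+1%:R^-1)); last first.
  rewrite -!ball_normE; apply/seteqP; split => -[t x] /= [tc xc]; split => /=.
  - by rewrite distrC.
  - by move=> i _ /=; rewrite distrC.
  - by rewrite distrC.
  - by move=> i; rewrite distrC; exact: (xc i I).
apply: measurableI.
  by rewrite -[X in measurable X]setTI; apply: measurable_fst => //;
    exact: measurable_ball.
apply: fin_bigcap_measurable => // i _.
rewrite -[X in measurable X]setTI.
have mi : measurable_fun [set: point] (@rV_coord R d i \o snd).
  by apply: measurableT_comp;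
    [exact: measurable_rV_coord|exact: measurable_snd].
by apply: mi => //; exact: measurable_ball.
Qed.

(** The boxes with rational centers and radii 1/(k+1) form a countable basis of
    the topology, and they belong to the product sigma-algebra. *)
Lemma open_measurable_spacetime (O : set point) : open O -> measurable O.
Proof.
move=> oO; rewrite (_ : O = \bigcup_c (rbox c `&` [set _ | rbox c `<=` O])).
  apply: countable_bigcupT_measurable => // c.
  have [cO|cO] := pselect (rbox c `<=` O).
    by rewrite (_ : [set _ | _] = setT) ?setIT//; apply/seteqP; split.
  by rewrite (_ : [set _ | _] = set0) ?setI0//; apply/seteqP; split.
apply/seteqP; split => [p Op|p [c _] [cp cO]]; last exact: cO.
have /nbhs_ballP[e /= e0 peO] : nbhs p O by exact: open_nbhs_nbhs.
pose k := Num.truncn (e / 2)^-1.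
have ke : k.+1%:R^-1 < e / 2 :> R.
  by rewrite invf_plt ?posrE ?divr_gt0// truncnS_gt.
have kgt0 : 0 < k.+1%:R^-1 :> R by rewrite invr_gt0.
have rat_near (x : R) : exists r : rat, `|x - ratr r| < k.+1%:R^-1.
  have /rat_in_itvoo[r rx] : x - k.+1%:R^-1 < x + k.+1%:R^-1.
    by rewrite ltrBlDr -addrA ltrDl addr_gt0.
  by exists r; rewrite distrC ltr_distl !(itvP rx).
have [q pq] := rat_near p.1.
have /choice[s ps] : forall i, exists r : rat, `|p.2 ord0 i - ratr r|
  < k.+1%:R^-1.
  by move=> i; exact: rat_near.
pose c := (q, \row_i s i, k).
have cp : rbox c p by split => //= i; rewrite mxE.
have cO : rbox c `<=` O.
  move=> p' [p'q p's]; apply: peO; split.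
    change (ball p.1 e p'.1); apply: (@ball_splitl R R (ratr q : R));
      rewrite -ball_normE /=.
      by rewrite (lt_trans _ ke)// distrC.
    by rewrite (lt_trans _ ke)// distrC.
  split => // i j; rewrite ord1; change (ball (p.2 ord0 j) e (p'.2 ord0 j)).
  apply: (@ball_splitl R R (ratr (s j) : R)).
    by rewrite -ball_normE /= (lt_trans _ ke)// distrC.
  have := p's j; rewrite mxE => p'j.
  by rewrite -ball_normE /= (lt_trans _ ke)// distrC.
by exists c.
Qed.

(** A closed set of states is the section at time 0 of a closed set of
    space-time, and sections of measurable sets are measurable. *)
Lemma closed_measurable_rV (K : set 'rV[R]_d) : closed K -> measurable K.
Proof.
move=> cK; have mK : measurable ((snd : point -> _) @^-1` K).
  rewrite -[X in measurable X]setCK; apply: measurableC.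
  apply: open_measurable_spacetime; rewrite preimage_setC.
  by apply: open_comp; [move=> p _; exact: cvg_snd|exact: closed_openC].
have -> : K = (pair (0 : R)) @^-1` ((snd : point -> _) @^-1` K) by [].
rewrite -[X in measurable X]setTI.
by apply: measurable_pair1.
Qed.

Lemma measurable_cube : measurable (cube d : set 'rV[R]_d).
Proof.
rewrite (_ : cube d = \bigcap_i (@rV_coord R d i @^-1` `[0, 1[)); last first.
  apply/seteqP; split => x /= xd; first by move=> i _ /=; rewrite in_itv/= xd.
  by move=> i; have := xd i I; rewrite /= in_itv.
apply: fin_bigcap_measurable => // i _; rewrite -[X in measurable X]setTI.
by apply: measurable_rV_coord => //; exact: measurable_itv.
Qed.

Lemma measurable_cylinder (T : R) : measurable (cylinder T : set point).
Proof.
by apply: measurableX => //; exact: measurable_cube.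
Qed.

Lemma volume_cylinder_lty (T : R) : (volume d (cylinder T) < +oo)%E.
Proof.
have mc := measurable_cube.
have -> : volume d (cylinder T) =
    (time_lebesgue `[0%R, T] * torus_measure d (cube d))%E.
  by exact: product_measure1E.
rewrite (@le_lt_trans _ _ (time_lebesgue `[0%R, T] * 1)%E)//.
  by rewrite lee_pmul//; exact: probability_le1.
rewrite mule1 /time_lebesgue lebesgue_measure_itv/=.
by case: ifP => // _; rewrite sube0 ltry.
Qed.

Lemma continuous_strip_measurable (T : R) (f : point -> R) :
  {within strip T, continuous f} -> measurable_fun (cylinder T) f.
Proof.
move=> /continuousP cf _.
have mC := measurable_cylinder T.
apply: (measurability _ (RGenOpens.measurableE R)) => //.
move=> _ [_ [a [b ->]] <-].
have /cf /open_subspaceP[V oV VE] : open (`]a, b[%classic : set R).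
  exact: interval_open.
have CS : cylinder T `<=` (strip T : set point) by move=> p [? _]; split.
have -> : cylinder T `&` f @^-1` `]a, b[ = cylinder T `&` V.
  have sub (Y Z : set point) : Y `&` strip T `<=` Z ->
    cylinder T `&` Y `<=` cylinder T `&` Z.
    by move=> YZ p [Cp Yp]; split=> //; apply: YZ; split=> //; exact: CS.
  apply/seteqP; split; apply: sub; [rewrite -VE|rewrite VE]; exact: subIsetl.
by apply: measurableI => //; exact: open_measurable_spacetime.
Qed.

(** The closure of the cylinder is compact, and the strip still contains it. *)
Lemma continuous_strip_bounded (T : R) (f : point -> R) :
  {within strip T, continuous f} -> [bounded f p | p in cylinder T].
Proof.
move=> cf.
pose K : set point :=
  `[0, T] `*` [set x : 'rV[R]_d | forall i, `[0, 1]%classic (x ord0 i)].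
have cK : compact K.
  apply: compact_setX; first exact: segment_compact.
  apply: (@rV_compact R d (fun=> `[0, 1]%classic)) => _; exact: segment_compact.
have KS : K `<=` (strip T : set point) by move=> p [? _]; split.
have /compact_bounded : compact (f @` K).
  by apply: continuous_compact cK; exact: continuous_subspaceW cf.
move=> [M [Mr fM]]; exists M; split=> // r Mr' p [pT px]; apply: fM => //.
exists p => //; split=> // i /=; rewrite in_itv/=.
by have /andP[-> /ltW ->] := px i.
Qed.

End spacetime_regularity.

Section within_continuous_state.
Context {R : realType} (n : nat).

Lemma continuous_closed_measurable (K : set 'rV[R]_n) (g : 'rV[R]_n -> R) :
  closed K -> {within K, continuous g} -> measurable_fun K g.
Proof.
move=> cK /continuousP cg _.
have mK : measurable K by exact: closed_measurable_rV.
apply: (measurability _ (RGenOpens.measurableE R)) => //.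
move=> _ [_ [a [b ->] <-]].
have /cg /open_subspaceP[V oV VE] : open (`]a, b[%classic : set R).
  exact: interval_open.
rewrite setIC -VE; apply: measurableI => //.
rewrite -[X in measurable X]setCK; apply: measurableC.
by apply: closed_measurable_rV; exact: open_closedC.
Qed.

End within_continuous_state.

(** * Periodic continuous functions *)

Section continuous_on_cylinder.
Context {R : realType} (d : nat) (T : R).
Local Notation point := (R * 'rV[R]_d)%type.
Implicit Types f g : point -> R.

Lemma continuous_cylinder_cst (W : topologicalType) (w : W) :
  continuous_cylinder T (fun _ : point => w).
Proof. by split=> //; exact: cst_continuous. Qed.

(** Continuity of [k] is required on [D] only, so that functions which are
    smooth on X but not on its closure are covered. *)
Lemma continuous_cylinder_comp (V W : topologicalType) (D : set V)
    (u : point -> V) (k : V -> W) :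
  (forall v, D v -> {for v, continuous k}) ->
    (forall p, strip T p -> D (u p)) ->
  continuous_cylinder T u -> continuous_cylinder T (k \o u).
Proof.
move=> ck uD [/subspace_continuousP cu pu]; split; last first.
  by move=> p a Tp /=; rewrite pu.
apply/subspace_continuousP => p Tp.
by apply: (@cvg_comp _ _ _ u k); [exact: cu|apply: ck; exact: uD].
Qed.

Lemma continuous_cylinderD f g : continuous_cylinder T f ->
  continuous_cylinder T g -> continuous_cylinder T (fun p => f p + g p).
Proof.
move=> [cf pf] [cg pg]; split; last by move=> p a Tp; rewrite pf// pg.
by move=> p; apply: continuousD; [exact: cf|exact: cg].
Qed.

Lemma continuous_cylinderM f g : continuous_cylinder T f ->
  continuous_cylinder T g -> continuous_cylinder T (fun p => f p * g p).
Proof.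
move=> [cf pf] [cg pg]; split; last by move=> p a Tp; rewrite pf// pg.
by move=> p; apply: continuousM; [exact: cf|exact: cg].
Qed.

Lemma continuous_cylinderN f : continuous_cylinder T f ->
  continuous_cylinder T (fun p => - f p).
Proof.
move=> [cf pf]; split; last by move=> p a Tp; rewrite pf.
by move=> p; apply: continuousN; exact: cf.
Qed.

Lemma continuous_cylinder_sum (I : Type) (r : seq I) (P : pred I)
    (f : I -> point -> R) :
  (forall i, continuous_cylinder T (f i)) ->
  continuous_cylinder T (fun p => \sum_(i <- r | P i) f i p).
Proof.
move=> cf; elim: r => [|i r ih].
  by under eq_fun do rewrite big_nil; exact: continuous_cylinder_cst.
under eq_fun do rewrite big_cons.
by case: (P i) => //; exact: continuous_cylinderD.
Qed.

Lemma continuous_cylinder_prod (I : Type) (r : seq I) (P : pred I)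
    (f : I -> point -> R) :
  (forall i, continuous_cylinder T (f i)) ->
  continuous_cylinder T (fun p => \prod_(i <- r | P i) f i p).
Proof.
move=> cf; elim: r => [|i r ih].
  by under eq_fun do rewrite big_nil; exact: continuous_cylinder_cst.
under eq_fun do rewrite big_cons.
by case: (P i) => //; exact: continuous_cylinderM.
Qed.

Lemma continuous_cylinderV f : (forall p, strip T p -> f p != 0) ->
  continuous_cylinder T f -> continuous_cylinder T (fun p => (f p)^-1).
Proof.
move=> f0; apply: (@continuous_cylinder_comp _ _ [set x : R | x != 0]).
  by move=> x /= x0; apply: continuousV => //; exact: cvg_id.
exact: f0.
Qed.

Lemma continuous_cylinder_clamp f : continuous_cylinder T f ->
  continuous_cylinder T (fun p => Num.min 1 (Num.max 0 (f p))).
Proof.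
apply: (@continuous_cylinder_comp _ _ setT f (fun x : R =>
  Num.min 1 (Num.max 0 x))) => // x _.
apply: continuous_min; first exact: cvg_cst.
by apply: continuous_max; [exact: cvg_cst|exact: cvg_id].
Qed.

Lemma continuous_cylinder_time : continuous_cylinder T (fst : point -> R).
Proof.
split; first by apply: continuous_subspaceT => p; exact: cvg_fst.
by move=> [t x] a _ /=; rewrite addr0.
Qed.

(** Both factors change sign when the coordinate increases by 1, hence their
    product is periodic.  Together with [arc_gt0] this exhibits the points of
    the cylinder with i-th coordinate > a as a superlevel set of a test
    function. *)
Lemma continuous_cylinder_arc (i : 'I_d) (a : R) :
  continuous_cylinder T
    (fun p : point => sin (pi * p.2 ord0 i) * sin (pi * (p.2 ord0 i - a))).
Proof.
have ci : continuous (fun p : point => p.2 ord0 i).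
  by move=> p; apply: (@cvg_comp _ _ _ snd (fun x : 'rV[R]_d => x ord0 i));
    [exact: cvg_snd|exact: coord_continuous].
split.
  apply: continuous_subspaceT => p; apply: continuousM; apply: continuous_comp;
    try exact: continuous_sin; apply: continuousM; try exact: cvg_cst.
    exact: ci.
  by apply: continuousB; [exact: ci|exact: cvg_cst].
move=> [t x] b _ /=; rewrite !mxE eqxx/=.
have [_|_] := eqVneq i b; last by rewrite addr0.
by rewrite [x ord0 i + _ - a]addrAC !mulrDr mulr1 !sinDpi mulrNN.
Qed.

End continuous_on_cylinder.

Section matrix_continuity.
Context {R : realType} (d : nat) (T : R).
Local Notation point := (R * 'rV[R]_d)%type.

(** Useful for formulas, such as the one for the inverse matrix, that hold on
    the strip only. *)
Lemma eq_continuous_cylinder (W : topologicalType) (f g : point -> W) :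
  (forall p, strip T p -> f p = g p) ->
  continuous_cylinder T f -> continuous_cylinder T g.
Proof.
move=> fg [cf pf]; split.
  apply: (@subspace_eq_continuous _ _ _ f) cf => p /set_mem; exact: fg.
move=> p a Tp; rewrite -!fg ?pf//.
by case: Tp => pT _; split; rewrite /= ?addr0.
Qed.

Lemma continuous_cylinder_det k (M : point -> 'M[R]_k) :
  (forall i j, continuous_cylinder T (fun p => M p i j)) ->
  continuous_cylinder T (fun p => \det (M p)).
Proof.
move=> cM; rewrite /determinant; apply: continuous_cylinder_sum => s.
apply: continuous_cylinderM; first exact: continuous_cylinder_cst.
exact: continuous_cylinder_prod.
Qed.

(** Cramer's rule. *)
Lemma continuous_cylinder_invmx k (M : point -> 'M[R]_k) :
  (forall p, strip T p -> M p \in unitmx) ->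
  (forall i j, continuous_cylinder T (fun p => M p i j)) ->
  forall i j, continuous_cylinder T (fun p => invmx (M p) i j).
Proof.
move=> uM cM i j.
apply: (@eq_continuous_cylinder _ (fun p => (\det (M p))^-1 *
    ((-1) ^+ (j + i) * \det (row' j (col' i (M p)))))).
  by move=> p Tp; rewrite /invmx uM// !mxE.
apply: continuous_cylinderM.
  apply: continuous_cylinderV; last exact: continuous_cylinder_det.
  by move=> p Tp; rewrite -unitfE -unitmxE uM.
apply: continuous_cylinderM; first exact: continuous_cylinder_cst.
apply: continuous_cylinder_det => a b.
by under eq_fun do rewrite !mxE; exact: cM.
Qed.

Lemma space_periodic_integer (W : Type) (f : point -> W) t (x : 'rV[R]_d)
    (a : 'I_d) (z : int) : 0 <= t <= T -> space_periodic (strip T) f ->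
  f (t, x + z%:~R *: delta_mx ord0 a) = f (t, x).
Proof.
move=> tT pf.
have step y : f (t, y + delta_mx ord0 a) = f (t, y).
  have := pf (t, y) a; rewrite /space_dir /= => <-; first by congr f;
    congr pair; rewrite /= addr0.
  by split; rewrite //= in_itv.
have steps (k : nat) y : f (t, y + k%:R *: delta_mx ord0 a) = f (t, y).
  elim: k => [|k ih]; first by rewrite scale0r addr0.
  by rewrite -natr1 scalerDl scale1r addrA step.
case: z => k; first exact: steps.
by rewrite NegzE -[in RHS](subrK (k.+1%:R *: delta_mx ord0 a) x) mulrNz
  -scaleNr steps.
Qed.

(** Subtracting the integer parts of the coordinates, one coordinate at a time,
    moves any point of the strip into the cylinder without changing [f]. *)
Lemma strip_periodic_range (W : Type) (f : point -> W) (P : W -> Prop) :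
  space_periodic (strip T) f -> (forall p, cylinder T p -> P (f p)) ->
  forall p, strip T p -> P (f p).
Proof.
move=> pf fP [t x] [/= tT _].
have tT' : 0 <= t <= T by move: tT; rewrite in_itv.
pose y (s : seq 'I_d) : 'rV[R]_d :=
  \row_a (if a \in s then x ord0 a - (Num.floor (x ord0 a))%:~R else x ord0 a).
have yE s : uniq s -> f (t, y s) = f (t, x).
  elim: s => [_|a s ih /= /andP[as_ us]].
    by congr f; congr pair; apply/rowP => a; rewrite !mxE.
  rewrite -(ih us) -[RHS](@space_periodic_integer _ _ _ _ a
    (- Num.floor (x ord0 a)) tT' pf).
  congr f; congr pair; apply/rowP => b; rewrite !mxE eqxx /= inE mulrNz.
  have [->|ba] := eqVneq b a; last by rewrite mulr0 addr0.
  by rewrite (negbTE as_) mulr1.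
rewrite -(yE _ (enum_uniq 'I_d)); apply: fP; split => //= a.
rewrite mxE mem_enum /= subr_ge0 floor_le_tmp ltrBlDr addrC /=.
by have := floorD1_gt (x ord0 a); rewrite intrD.
Qed.

End matrix_continuity.

Section charge_integral_coefficients.
Context {R : realType} (d : nat) (T : R).
Local Notation point := (R * 'rV[R]_d)%type.
Local Notation cyl := (cylinder T : set point).
Variable (E : set point) (mE : measurable E) (EC : E `<=` cyl).
Implicit Types (h : point -> R) (m : {charge set point -> \bar R}).

Lemma continuous_cylinder_measurableS h :
  continuous_cylinder T h -> measurable_fun E h.
Proof.
move=> [ch _]; apply: measurable_funS (continuous_strip_measurable ch) => //.
exact: measurable_cylinder.
Qed.

Lemma continuous_cylinder_boundedS h :
  continuous_cylinder T h -> [bounded h p | p in E].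
Proof.
move=> [/continuous_strip_bounded[M [Mr hM]] _]; exists M;
  split=> // r Mr' p /EC.
exact: hM.
Qed.

Lemma charge_integralZ m c h : continuous_cylinder T h ->
  charge_integral m E (fun p => c * h p) = c * charge_integral m E h.
Proof.
move=> ch; have := charge_integral_lincomb m mE (fun _ : unit => c)
  (fun _ => continuous_cylinder_measurableS ch)
  (fun _ => continuous_cylinder_boundedS ch).
rewrite (big_pred1 tt) => [<-|]; last by case.
by congr charge_integral; apply/funext => p; rewrite (big_pred1 tt) //; case.
Qed.

Lemma charge_integral_cst m c : charge_integral m E (fun=> c) = c * fine (m E).
Proof.
have [mu [g gP]] := charges_have_densities (fun _ : unit => m).
have [ig muE] := gP tt.
rewrite (charge_integral_density ig muE)//; last exact: bounded_cst.
by rewrite RintegralZl ?muE//; exact: integrableS ig.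
Qed.

End charge_integral_coefficients.

(** * Approximation of measurable sets by periodic continuous functions *)

Section arc.
Context {R : realType}.

Lemma arc_gt0 (a x : R) : 0 <= a < 1 -> 0 <= x < 1 ->
  (0 < sin (pi * x) * sin (pi * (x - a))) = (a < x).
Proof.
move=> /andP[a0 a1] /andP[x0 x1].
have [->|xn0] := eqVneq x 0; first by rewrite mulr0 sin0 mul0r ltxx le_gtF.
have {xn0} x0' : 0 < x by rewrite lt_neqAle eq_sym xn0.
have pos y : 0 < y -> y < 1 -> 0 < sin (pi * y) :> R.
  move=> y0 y1; apply: sin_gt0_pi.
  by rewrite mulr_gt0 ?pi_gt0//= gtr_pMr ?pi_gt0.
rewrite pmulr_rgt0; last exact: pos.
have [ax|] := ltP a x.
  by rewrite pos// ?subr_gt0// ltrBlDr (lt_le_trans x1)// lerDl.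
rewrite le_eqVlt => /predU1P[->|xa]; first by rewrite subrr mulr0 sin0 ltxx.
rewrite -opprB mulrN sinN oppr_gt0; apply/negbTE; rewrite -leNgt ltW//.
by apply: pos; rewrite ?subr_gt0// ltrBlDr (lt_le_trans a1)// lerDl.
Qed.

End arc.

(** The sets whose preimage under [h] lies in the sigma-algebra [C] form a
    sigma-algebra. *)
Lemma preimage_sigma_algebra (aT rT : Type) (C : set_system aT)
    (h : aT -> rT) (H : set_system rT) : sigma_algebra setT C ->
  (forall B, H B -> C (h @^-1` B)) -> forall B, <<s H >> B -> C (h @^-1` B).
Proof.
move=> [C0 CC CU] CH; apply: smallest_sub => //; split => [|B CB|B CB] /=.
- by rewrite preimage_set0.
- by rewrite setTD preimage_setC -setTD; exact: CC.
- by rewrite preimage_bigcup; exact: CU.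
Qed.

Section approximation.
Context {R : realType} (d : nat) (T : R).
Local Notation point := (R * 'rV[R]_d)%type.
Local Notation cyl := (cylinder T : set point).
Variables (mu : {finite_measure set point -> \bar R}) (w : point -> R).
Hypotheses (w0 : forall p, 0 <= w p) (iw : mu.-integrable cyl (EFin \o w)).
Implicit Types (f g : point -> R) (E : set point).

Let mcyl : measurable cyl := measurable_cylinder T.

Let unit_fun f := measurable_fun cyl f /\ forall p, cyl p -> 0 <= f p <= 1.

Let dist f g : R := \int[mu]_(p in cyl) (`|f p - g p| * w p).

(** Approximation in the mean with weight [w], which will be the absolute value
    of the density of a charge.  Keeping the values in [0, 1] makes products
    of approximations converge. *)
Definition cylinder_approximable f := unit_fun f /\
  forall e, 0 < e -> exists phi : point -> R,
    [/\ continuous_cylinder T phi, forall p, 0 <= phi p <= 1 & dist phi f < e].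

Let integrable_dist f g : unit_fun f -> unit_fun g ->
  mu.-integrable cyl (fun p => (`|f p - g p| * w p)%:E).
Proof.
move=> [mf f01] [mg g01]; apply: integrable_bounded_mul => //.
  by apply: measurableT_comp => //; exact: measurable_funB.
exists 1; split=> // r r1 p Cp; apply: le_trans (ltW r1).
have /andP[? ?] := f01 p Cp; have /andP[? ?] := g01 p Cp.
by rewrite /= normr_id ler_norml; apply/andP; split; lra.
Qed.

Let unit_continuous (phi : point -> R) : continuous_cylinder T phi ->
  (forall p, 0 <= phi p <= 1) -> unit_fun phi.
Proof.
by move=> [cphi _] phi01; split=> //; exact: continuous_strip_measurable.
Qed.

Lemma cylinder_approximable_continuous (phi : point -> R) :
  continuous_cylinder T phi ->
  (forall p, 0 <= phi p <= 1) -> cylinder_approximable phi.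
Proof.
move=> cphi phi01; split; first exact: unit_continuous.
move=> e e0; exists phi; split => //; rewrite /dist.
by under eq_Rintegral do rewrite subrr normr0 mul0r;
  rewrite Rintegral_cst// mul0r.
Qed.

Let dist_triangle f g h : unit_fun f -> unit_fun g -> unit_fun h ->
  dist f h <= dist f g + dist g h.
Proof.
move=> uf ug uh; rewrite /dist -RintegralD//; try exact: integrable_dist.
apply: le_Rintegral => //; first exact: integrable_dist.
  by apply: (integrableD _ (integrable_dist uf ug) (integrable_dist ug uh)).
by move=> p Cp; rewrite -mulrDl ler_wpM2r// ler_distD.
Qed.

(** Dominated convergence, with [w] as the dominating function. *)
Lemma cylinder_approximable_lim (f_ : nat -> point -> R) f :
  (forall n, cylinder_approximable (f_ n)) -> unit_fun f ->
  (forall p, cyl p -> f_ n p @[n --> \oo] --> f p) -> cylinder_approximable f.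
Proof.
move=> af_ uf cf; split=> // e e0; have e20 : 0 < e / 2 by rewrite divr_gt0.
have : dist (f_ n) f @[n --> \oo] --> \int[mu]_(p in cyl) (cst 0 p).
  apply: (@Rintegral_dominated_cvg _ _ _ _ _ _ _ _ w) => //.
  - by move=> n; apply/measurable_EFinP;
      exact: measurable_int (integrable_dist (af_ n).1 uf).
  - apply: aeW => p Cp; rewrite /cst -(mul0r (w p)) -(normr0 R) -(subrr (f p)).
    apply: cvgM; last exact: cvg_cst.
    by apply: cvg_norm; apply: cvgB; [exact: cf|exact: cvg_cst].
  - apply: aeW => p n Cp; rewrite normrM normr_id (ger0_norm (w0 p)) ler_piMl//.
    have /andP[? ?] := (af_ n).1.2 p Cp; have /andP[? ?] := uf.2 p Cp.
    by rewrite ler_norml; apply/andP; split; lra.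
rewrite Rintegral_cst// mul0r => /cvgrPdist_lt/(_ _ e20)[N _ /(_ N (leqnn N))].
rewrite /= sub0r normrN => dN.
have [_ /(_ (e / 2) e20)[phi [cphi phi01 dphi]]] := af_ N.
exists phi; split=> //.
have uphi := unit_continuous cphi phi01.
apply: le_lt_trans (dist_triangle uphi (af_ N).1 uf) _.
by have := le_lt_trans (ler_norm _) dN; lra.
Qed.

Lemma cylinder_approximableC f :
  cylinder_approximable f -> cylinder_approximable (fun p => 1 - f p).
Proof.
move=> [[mf f01] af]; split; first split.
- exact: measurable_funB.
- by move=> p /f01/andP[? ?]; apply/andP; split; lra.
move=> e /af[phi [cphi phi01 phie]]; exists (fun p => 1 - phi p); split.
- apply: continuous_cylinderD; first exact: continuous_cylinder_cst.
  exact: continuous_cylinderN.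
- by move=> p; have /andP[? ?] := phi01 p; apply/andP; split; lra.
congr (_ < _) : phie; apply: eq_Rintegral => p _.
by rewrite distrC; congr (`|_| * _); lra.
Qed.

(** On [0, 1] the product is 1-Lipschitz in each factor. *)
Lemma cylinder_approximableM f g : cylinder_approximable f ->
  cylinder_approximable g -> cylinder_approximable (fun p => f p * g p).
Proof.
move=> [[mf f01] af] [[mg g01] ag].
have ufg : unit_fun (fun p => f p * g p).
  split; first exact: measurable_funM.
  move=> p Cp; have /andP[? ?] := f01 p Cp; have /andP[? ?] := g01 p Cp.
  by apply/andP; split; nra.
split=> // e e0; have e20 : 0 < e / 2 by rewrite divr_gt0.
have [phi [cphi phi01 phie]] := af _ e20.
have [psi [cpsi psi01 psie]] := ag _ e20.
have uphi := unit_continuous cphi phi01.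
have upsi := unit_continuous cpsi psi01.
have cc : continuous_cylinder T (fun p => phi p * psi p).
  exact: continuous_cylinderM.
have c01 p : 0 <= phi p * psi p <= 1.
  have /andP[? ?] := phi01 p; have /andP[? ?] := psi01 p.
  by apply/andP; split; nra.
exists (fun p => phi p * psi p); split=> //.
apply: (@le_lt_trans _ _ (dist phi f + dist psi g));
  last by rewrite (splitr e) ltrD.
rewrite /dist -RintegralD//; try exact: integrable_dist.
apply: le_Rintegral => //.
- by apply: integrable_dist => //; exact: unit_continuous.
- by apply: (integrableD _ (integrable_dist uphi _) (integrable_dist upsi _)).
move=> p Cp; rewrite -mulrDl ler_wpM2r//.
have -> : phi p * psi p - f p * g p =
  psi p * (phi p - f p) + f p * (psi p - g p) by ring.
have /andP[p0 p1] := psi01 p; have /andP[f0 f1] := f01 p Cp.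
rewrite (le_trans (ler_normD _ _))// !normrM (ger0_norm p0) (ger0_norm f0).
by rewrite lerD// ler_piMl.
Qed.

Let approximable_set E := measurable E /\ cylinder_approximable (\1_E).

Let unit_indic E : measurable E -> unit_fun (\1_E).
Proof.
move=> mE; split; first exact: measurable_indic.
by move=> p _; rewrite indicE; case: (_ \in _); rewrite /= ?ler01 ?lexx.
Qed.

(** A countable intersection is handled as the limit of the finite products of
    indicators, a countable union by passing to complements. *)
Lemma sigma_algebra_approximable : sigma_algebra setT approximable_set.
Proof.
have compl E : approximable_set E -> approximable_set (~` E).
  move=> [mE /cylinder_approximableC aE]; split; first exact: measurableC.
  congr cylinder_approximable : aE; apply/funext => p.
  by rewrite !indicE in_setC; case: (_ \in _); rewrite ?subrr ?subr0.
split; [|by move=> E; rewrite setTD; exact: compl|].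
  split=> //; rewrite indic0.
  apply: cylinder_approximable_continuous; first exact: continuous_cylinder_cst.
  by move=> p; rewrite ?lexx ?ler01.
move=> E aE; rewrite -[X in approximable_set X]setCK setC_bigcup;
  apply: (compl _).
have mE n : measurable (~` E n) by apply: measurableC; have [] := aE n.
split; first exact: bigcapT_measurable.
apply: (@cylinder_approximable_lim (fun n p => \prod_(k < n) \1_(~` E k) p)).
- elim=> [|n ih].
    under eq_fun do rewrite big_ord0.
    apply: cylinder_approximable_continuous;
      first exact: continuous_cylinder_cst.
    by move=> p; rewrite ?lexx ?ler01.
  under eq_fun do rewrite big_ord_recr.
  by apply: cylinder_approximableM => //; exact: (compl _ (aE n)).2.
- by apply: unit_indic; exact: bigcapT_measurable.
move=> p _; rewrite indicE.
have [pE|/negP pE] := boolP (p \in \bigcap_n ~` E n).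
  apply: cvg_near_cst; apply: nearW => n; rewrite big1// => k _.
  by rewrite indicE mem_set//; exact: (set_mem pE k I).
have {}pE : ~ (\bigcap_n ~` E n) p by move=> h; apply: pE; exact: mem_set.
move/existsNP : pE => [k /not_implyP[_ Ekp]].
apply: cvg_near_cst; exists k.+1 => // n /= kn.
(* From rank k + 1 on, the product has the vanishing factor of index k. *)
rewrite (bigD1 (Ordinal kn))//= indicE memNset ?mul0r//.
Qed.

(** The functions min(1, max(0, n phi)) converge to the indicator of the set
    where phi > 0. *)
Lemma approximable_superlevel (phi : point -> R) E :
  continuous_cylinder T phi ->
  measurable E -> (forall p, cyl p -> E p <-> 0 < phi p) -> approximable_set E.
Proof.
move=> cphi mE Ephi; split=> //.
apply: (@cylinder_approximable_lim
    (fun n p => Num.min 1 (Num.max 0 (n%:R * phi p)))).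
- move=> n; apply: cylinder_approximable_continuous.
    apply: continuous_cylinder_clamp; apply: continuous_cylinderM => //.
    exact: continuous_cylinder_cst.
  by move=> p; rewrite le_min ler01 le_max lexx /= ge_min lexx.
- exact: unit_indic.
move=> p Cp; rewrite indicE; apply: cvg_near_cst.
have [Ep|Ep] := boolP (p \in E).
  have phi0 : 0 < phi p by apply/(Ephi _ Cp); exact: set_mem.
  exists (Num.truncn (phi p)^-1).+1 => // n /= Nn.
  rewrite min_l// le_max; apply/orP; right.
  rewrite -ler_pdivrMr// mul1r (le_trans (ltW (truncnS_gt _)))//.
  by rewrite ler_nat.
apply: nearW => n; rewrite max_l ?min_r//.
rewrite mulr_ge0_le0// leNgt; apply/negP => /(Ephi _ Cp).
by move/mem_set; rewrite (negbTE Ep).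
Qed.

(** Half-spaces bounded by a coordinate hyperplane generate the product
    sigma-algebra, and within the cylinder they are superlevel sets of test
    functions. *)
Lemma measurable_approximable E : measurable E -> cylinder_approximable (\1_E).
Proof.
have sC := sigma_algebra_approximable.
suff : forall E, measurable E -> approximable_set E by move=> h /h[].
have time (B : set R) : measurable B -> approximable_set (fst @^-1` B).
  rewrite [measurable B](_ : _ = (@RGenOInfty.G R).-sigma.-measurable B);
    last first.
    by rewrite -RGenOInfty.measurableE.
  apply: preimage_sigma_algebra => // _ [x ->].
  apply: (@approximable_superlevel (fun p => p.1 - x)).
  - by apply: continuous_cylinderD;
      [exact: continuous_cylinder_time|exact: continuous_cylinder_cst].
  - by rewrite -[X in measurable X]setTI; apply: measurable_fst.
  - by move=> p _ /=; rewrite in_itv/= andbT subr_gt0.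
have space i (B : set R) : measurable B ->
  approximable_set ((fun p : point => p.2 ord0 i) @^-1` B).
  rewrite [measurable B](_ : _ = (@RGenOInfty.G R).-sigma.-measurable B);
    last first.
    by rewrite -RGenOInfty.measurableE.
  apply: preimage_sigma_algebra => // _ [x ->].
  have mE : measurable ((fun p : point => p.2 ord0 i) @^-1` `]x, +oo[).
    rewrite -[X in measurable X]setTI.
    have mi : measurable_fun [set: point] (@rV_coord R d i \o snd).
      by apply: measurableT_comp;
        [exact: measurable_rV_coord|exact: measurable_snd].
    exact: mi.
  have [x0|x0] := ltP x 0.
    apply: (@approximable_superlevel (cst 1)) => //.
      exact: continuous_cylinder_cst.
    move=> [t y] [_ /= /(_ i)/andP[y0 _]]; rewrite in_itv/= andbT ltr01.
    by rewrite (lt_le_trans x0 y0).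
  have [x1|x1] := leP 1 x.
    apply: (@approximable_superlevel (cst 0)) => //.
      exact: continuous_cylinder_cst.
    move=> [t y] [_ /= /(_ i)/andP[_ y1]]; rewrite in_itv/= andbT ltxx.
    by rewrite ltNge (ltW (lt_le_trans y1 x1)).
  apply: (approximable_superlevel (continuous_cylinder_arc T i x)) => //.
  move=> [t y] [_ /= /(_ i) y01]; rewrite in_itv/= andbT arc_gt0//.
  by rewrite x0.
move=> {}E; apply: smallest_sub => // _ [] [B mB <-]; rewrite setTI.
  exact: time.
apply: preimage_sigma_algebra mB => // B';
  rewrite -bigcup_seq => -[i _ [B'' mB'' <-]].
by rewrite setTI; exact: (space i).
Qed.

End approximation.

Section charge_positivity.
Context {R : realType} (d : nat) (T : R).
Local Notation point := (R * 'rV[R]_d)%type.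
Local Notation cyl := (cylinder T : set point).

(** The value of [m] on [E] and its pairing with a test function differ by at
    most the distance from the test function to the indicator of [E], in the
    mean weighted by the density of [m]. *)
Lemma charge_ge0_cylinder (m : {charge set point -> \bar R}) :
  (forall phi : point -> R, continuous_cylinder T phi ->
    (forall p, 0 <= phi p) ->
    0 <= charge_integral m cyl phi) ->
  forall E, measurable E -> E `<=` cyl -> (0 <= m E)%E.
Proof.
move=> m_ge0 E mE EC; have mcyl : measurable cyl := measurable_cylinder T.
have [mu [g gP]] := charges_have_densities (fun _ : unit => m).
have {gP} [ig muE] := gP tt.
have igC : mu.-integrable cyl (EFin \o g tt) by exact: integrableS ig.
have igE : mu.-integrable E (EFin \o g tt) by exact: integrableS ig.
have bE : [bounded (\1_E p : R) | p in cyl].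
  exists 1; split=> // r r1 p _; apply: le_trans (ltW r1).
  by rewrite /= indicE; case: (_ \in _); rewrite ?normr1 ?normr0.
have iE : mu.-integrable cyl (fun p => (\1_E p * g tt p)%:E).
  by apply: integrable_bounded_mul => //; exact: measurable_indic.
have -> : m E = (\int[mu]_(p in cyl) (\1_E p * g tt p))%:E.
  rewrite muE// /Rintegral fineK; last exact: integrable_fin_num.
  rewrite -{1}(setIidr EC) integral_mkcondr; apply: eq_integral => p _.
  by rewrite patchE indicE; case: ifPn => pE; rewrite ?mul1r ?mul0r.
rewrite lee_fin -oppr_le0; apply/ler_addgt0Pr => e e0; rewrite add0r.
have iw : mu.-integrable cyl (EFin \o (fun p => `|g tt p|)).
  exact: integrable_norm.
have [_ /(_ e e0)[phi [cphi phi01 phiE]]] :=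
  measurable_approximable (fun p => normr_ge0 (g tt p)) iw mE.
have mphi : measurable_fun cyl phi by apply: continuous_strip_measurable;
  case: cphi.
have bphi : [bounded phi p | p in cyl] by apply: continuous_strip_bounded;
  case: cphi.
have phi_ge0 : 0 <= \int[mu]_(p in cyl) (phi p * g tt p).
  rewrite -(charge_integral_density ig muE)//; apply: m_ge0 => // p.
  by have /andP[] := phi01 p.
have iphi : mu.-integrable cyl (fun p => (phi p * g tt p)%:E).
  exact: integrable_bounded_mul.
apply: le_trans (ltW phiE).
apply: (@le_trans _ _ (\int[mu]_(p in cyl) (phi p * g tt p - \1_E p * g tt p))).
  by rewrite RintegralB//; lra.
have iB : mu.-integrable cyl (fun p => (phi p * g tt p - \1_E p * g tt p)%:E).
  by apply: (integrableB _ iphi iE).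
apply: le_Rintegral => //.
  have := integrable_norm iB; apply: eq_integrable => // p _ /=.
  by rewrite -mulrBl normrM.
by move=> p Cp; rewrite -mulrBl (le_trans (ler_norm _))// normrM.
Qed.

End charge_positivity.

(** * Euclidean norm and cut-off functions *)

Section euclidean.
Context {R : realType} (n : nat).
Implicit Types v w : 'rV[R]_n.

Lemma enorm_continuous : continuous (@enorm R n).
Proof.
move=> v; apply: (@continuous_comp _ _ _ (fun v => dot v v) Num.sqrt).
  rewrite /dot; have -> : (fun v : 'rV[R]_n => \sum_i v ord0 i * v ord0 i) =
    \sum_i (fun v : 'rV[R]_n => v ord0 i * v ord0 i).
    by apply/funext => x; rewrite fct_sumE.
  elim/big_ind : _ => [|f g cf cg|i _].
  - exact: cst_continuous.
  - exact: continuousD.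
  - by apply: continuousM; exact: coord_continuous.
exact: sqrt_continuous.
Qed.

Lemma coord_le_enorm (v : 'rV[R]_n) i : `|v ord0 i| <= enorm v.
Proof.
rewrite /enorm -sqrtr_sqr ler_wsqrtr// /dot (bigD1 i)//= expr2 lerDl.
by apply: sumr_ge0 => j _; rewrite -expr2 sqr_ge0.
Qed.

Lemma dotvv_ge0 v : 0 <= dot v v.
Proof. by apply: sumr_ge0 => i _; rewrite -expr2 sqr_ge0. Qed.

Lemma sqr_enorm v : enorm v ^+ 2 = dot v v.
Proof. by rewrite sqr_sqrtr// dotvv_ge0. Qed.

(** The Cauchy-Schwarz inequality, obtained by expanding the square of the
    norm of |w| v - |v| w. *)
Lemma dot_le_enorm v w : dot v w <= enorm v * enorm w.
Proof.
have [v0|v0] := eqVneq (enorm v) 0; last have [w0|w0] := eqVneq (enorm w) 0.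
- rewrite v0 mul0r /dot big1// => i _.
  by have := coord_le_enorm v i; rewrite v0 normr_le0 => /eqP ->; rewrite mul0r.
- rewrite w0 mulr0 /dot big1// => i _.
  by have := coord_le_enorm w i; rewrite w0 normr_le0 => /eqP ->; rewrite mulr0.
have vw0 : 0 < enorm v * enorm w.
  by rewrite mulr_gt0// lt_neqAle eq_sym ?v0 ?w0 sqrtr_ge0.
have : 0 <= dot (enorm w *: v - enorm v *: w) (enorm w *: v - enorm v *: w).
  exact: dotvv_ge0.
have -> : dot (enorm w *: v - enorm v *: w) (enorm w *: v - enorm v *: w) =
  enorm w ^+ 2 * dot v v + enorm v ^+ 2 * dot w w -
  2 * (enorm v * enorm w) * dot v w.
  rewrite /dot !mulr_sumr -big_split -sumrB/=; apply: eq_bigr => i _.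
  by rewrite !mxE; ring.
rewrite -!sqr_enorm => h.
by rewrite -(ler_pM2l vw0); nra.
Qed.

End euclidean.

Section cutoff.
Context {R : realType} (n : nat).

Definition cutoff (r : R) (v : 'rV[R]_n) : R :=
  Num.min 1 (Num.max 0 (r + 1 - enorm v)).

Lemma cutoff_ge0 r v : 0 <= cutoff r v.
Proof. by rewrite /cutoff le_min ler01 le_max lexx. Qed.

Lemma cutoff_le1 r v : cutoff r v <= 1.
Proof. by rewrite /cutoff ge_min lexx. Qed.

Lemma cutoff1 r v : enorm v <= r -> cutoff r v = 1.
Proof. by move=> vr; rewrite /cutoff min_l// le_max lerBrDl lerD2r vr orbT. Qed.

Lemma cutoff0 r v : r + 1 <= enorm v -> cutoff r v = 0.
Proof.
by move=> vr; rewrite /cutoff max_l ?min_r// subr_le0.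
Qed.

Lemma cutoff_continuous r : continuous (cutoff r).
Proof.
move=> v; apply: (@continuous_comp _ _ _ (fun v => r + 1 - enorm v)
  (fun x : R => Num.min 1 (Num.max 0 x))).
  by apply: (@continuousB _ _ _ (fun=> r + 1) (@enorm R n));
    [exact: cst_continuous|exact: enorm_continuous].
apply: continuous_min; first exact: cvg_cst.
by apply: continuous_max; [exact: cvg_cst|exact: cvg_id].
Qed.

End cutoff.

(** * Limits along a sequence generating a Young measure *)

Section kernel_average.
Context {R : realType} (d n : nat) (T : R).
Local Notation point := (R * 'rV[R]_d)%type.
Local Notation state := 'rV[R]_n.
Local Notation cyl := (cylinder T : set point).
Variables (X : set state) (nu : R.-pker point ~> state).

(** Linearity of the integral determines averages only where the integrands are
    integrable, which may fail on a null set; measurability therefore comes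
    from the kernel, applied to the positive and negative parts of [f]. *)
Lemma measurable_average (f : point -> state -> R) :
  measurable_fun (cyl `*` closure X) (fun z => f z.1 z.2) ->
  measurable_fun cyl (average X nu f).
Proof.
move=> mf; have mcyl : measurable cyl := measurable_cylinder T.
have mX : measurable (closure X) by apply: closed_measurable_rV;
  exact: closed_closure.
have mCX : measurable (cyl `*` closure X) by exact: measurableX.
pose k : point * state -> \bar R :=
  ((fun z => (f z.1 z.2)%:E) \_ (cyl `*` closure X)).
have mk : measurable_fun setT k.
  by apply/(measurable_restrictT _ mCX)/measurable_EFinP.
have mp : measurable_fun setT (fun p => \int[nu p]_y (k^\+)%E (p, y))%E.
  by apply: measurable_fun_integral_finite_kernel => //;
    exact: measurable_funepos.
have mn : measurable_fun setT (fun p => \int[nu p]_y (k^\-)%E (p, y))%E.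
  by apply: measurable_fun_integral_finite_kernel => //;
    exact: measurable_funeneg.
apply: (@eq_measurable_fun _ _ _ _ _ (fun p => fine
   (\int[nu p]_y (k^\+)%E (p, y) - \int[nu p]_y (k^\-)%E (p, y))%E)).
  move=> p /set_mem Cp; rewrite /average /Rintegral; congr fine.
  rewrite [in RHS]integral_mkcond [in RHS]integralE.
  have kE y : ((fun y => (f p y)%:E) \_ (closure X)) y = k (p, y).
    rewrite /k !patchE; congr (if _ then _ else _).
    by apply/idP/idP => /set_mem h; apply/mem_set; [split|case: h].
  by congr (_ - _)%E; apply: eq_integral => y _; rewrite ?funeposE ?funenegE kE.
apply: measurable_funTS; apply: measurableT_comp => //.
exact: emeasurable_funB.
Qed.

End kernel_average.

Section linear_combinations.
Context {R : realType} (d n : nat) (T : R).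
Local Notation point := (R * 'rV[R]_d)%type.
Local Notation state := 'rV[R]_n.
Local Notation cyl := (cylinder T : set point).
Local Notation vol := (volume d : {measure set point -> \bar R}).
Variables (X : set state) (nu : R.-pker point ~> state) (u : nat -> point ->
  state).

Let mcyl : measurable cyl := measurable_cylinder T.

Let mX : measurable (closure X).
Proof. by apply: closed_measurable_rV; exact: closed_closure. Qed.

Let mCX : measurable (cyl `*` closure X). Proof. exact: measurableX. Qed.

Let measurable_phi (phi : point -> R) : continuous_cylinder T phi ->
  measurable_fun cyl phi.
Proof. by case=> ? _; exact: continuous_strip_measurable. Qed.

Let bounded_phi (phi : point -> R) : continuous_cylinder T phi ->
  [bounded phi p | p in cyl].
Proof. by case=> ? _; exact: continuous_strip_bounded. Qed.

Let integrable_phi (phi g : point -> R) : continuous_cylinder T phi ->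
  vol.-integrable cyl (EFin \o g) ->
  vol.-integrable cyl (fun p => (phi p * g p)%:E).
Proof.
move=> cphi ig; apply: integrable_bounded_mul => //.
  exact: measurable_phi.
exact: bounded_phi.
Qed.

(** The statement [concentration T X u nu f m] is the instance of this one where
    [L] is the integral over the cylinder against [m].  Allowing any functional
    [L] makes it possible to express, by [L] = 0, that nothing concentrates. *)
Definition converges_with_defect (f : point -> state -> R)
    (L : (point -> R) -> R) :=
  [/\ forall k, vol.-integrable cyl (fun p => (f p (u k p))%:E),
      averageable X vol cyl nu f
    & forall phi : point -> R, continuous_cylinder T phi ->
        \int[vol]_(p in cyl) (phi p * f p (u k p)) @[k --> \oo] -->
        \int[vol]_(p in cyl) (phi p * average X nu f p) + L phi].

Section combination.
Variables (J : finType) (h : J -> point -> R).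
Hypothesis ch : forall j, continuous_cylinder T (h j).

(** A test function times a coefficient is a test function, with which the
    convergence of each [g j] may be tested. *)
Lemma converges_with_defect_lincomb (g : J -> state -> R)
    (L : J -> (point -> R) -> R) :
  (forall j, measurable_fun (closure X) (g j)) ->
  (forall j, converges_with_defect (fun=> g j) (L j)) ->
  converges_with_defect (fun p v => \sum_j h j p * g j v)
    (fun phi => \sum_j L j (fun p => phi p * h j p)).
Proof.
move=> mg cg; set f := fun p v => _.
have ig j k : vol.-integrable cyl (fun p => (h j p * g j (u k p))%:E).
  by apply: integrable_phi => //; have [+ _ _] := cg j; exact.
have iav j : vol.-integrable cyl (EFin \o average X nu (fun=> g j)).
  by have [_ [_ ?] _] := cg j.
have ihav j : vol.-integrable cyl (fun p =>
  (h j p * average X nu (fun=> g j) p)%:E).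
  exact: integrable_phi.
have aeg : {ae vol, forall p, forall j, cyl p ->
    (nu p).-integrable (closure X) (EFin \o g j)}.
  by apply: filter_forall => j; have [_ [? _] _] := cg j.
have igp p j : (nu p).-integrable (closure X) (EFin \o g j) ->
    (nu p).-integrable (closure X) (EFin \o (fun v => h j p * g j v)).
  by move=> /(integrableZl mX (h j p)); apply: eq_integrable => // v _;
    rewrite /= EFinM.
have averageE : {ae vol, forall p, cyl p ->
    average X nu f p = \sum_j h j p * average X nu (fun=> g j) p}.
  apply: filterS aeg => p ig' Cp; rewrite /average /f Rintegral_sum//;
    last first.
    by move=> j; apply: igp; exact: ig'.
  by apply: eq_bigr => j _; rewrite RintegralZl//; exact: ig'.
have mavf : measurable_fun cyl (average X nu f).
  apply: measurable_average; apply: measurable_sum => j.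
  apply: measurable_funM.
    apply: (@measurable_comp _ _ _ _ _ _ cyl (h j)) => //.
    - by move=> _ [[p v] [Cp _] <-].
    - exact: measurable_phi.
    - by apply: measurable_funTS; exact: measurable_fst.
  apply: (@measurable_comp _ _ _ _ _ _ (closure X) (g j)) => //.
  - by move=> _ [[p v] [_ Xv] <-].
  - by apply: measurable_funTS; exact: measurable_snd.
have iavf : vol.-integrable cyl (EFin \o average X nu f).
  by apply: (ae_integrable mcyl mavf _ averageE); exact: integrable_Rsum.
split.
- by move=> k; rewrite /f; apply: integrable_Rsum => // j; exact: ig.
- split=> //; apply: filterS aeg => p ig' Cp.
  by rewrite /f; apply: integrable_Rsum => // j; apply: igp; exact: ig'.
move=> phi cphi.
have -> : \int[vol]_(p in cyl) (phi p * average X nu f p) =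
    \sum_j \int[vol]_(p in cyl) (phi p * h j p * average X nu (fun=> g j) p).
  rewrite -Rintegral_sum//; last first.
    by move=> j; apply: integrable_phi => //; exact: continuous_cylinderM.
  apply: ae_eq_Rintegral => //.
  - by apply: measurable_funM => //; exact: measurable_phi.
  - apply: measurable_sum => j; apply: measurable_funM.
      by apply: measurable_phi; exact: continuous_cylinderM.
    by apply/measurable_EFinP; exact: measurable_int (iav j).
  - apply: filterS averageE => p + Cp => ->//.
    by rewrite mulr_sumr; apply: eq_bigr => j _; rewrite mulrA.
have -> : (fun k => \int[vol]_(p in cyl) (phi p * f p (u k p))) =
    (fun k => \sum_j \int[vol]_(p in cyl) (phi p * h j p * g j (u k p))).
  apply/funext => k; rewrite -Rintegral_sum//; last first.
    move=> j; apply: integrable_phi; first exact: continuous_cylinderM.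
    by have [+ _ _] := cg j; exact.
  by apply: eq_Rintegral => p _; rewrite mulr_sumr; apply: eq_bigr => j _;
    rewrite mulrA.
rewrite -big_split/=; apply: cvg_big => [|j _]; first exact: add_continuous.
by have [_ _] := cg j; apply; exact: continuous_cylinderM.
Qed.

End combination.

Hypothesis u_range : forall k, measurable_fun cyl (u k) /\
  forall p, cyl p -> closure X (u k p).
Hypothesis young : young_measure T X u nu.

(** The Young measure gives the limits of continuous functions that vanish at
    infinity; integrability holds because [g] is bounded, its support being
    compact in the closure of X. *)
Lemma compact_support_no_defect (g : state -> R) (r : R) :
  {within closure X, continuous g} ->
  (forall v, closure X v -> r <= enorm v -> g v = 0) ->
  converges_with_defect (fun=> g) (fun=> 0).
Proof.
move=> cg g0.
have mg : measurable_fun (closure X) g.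
  by apply: continuous_closed_measurable => //; exact: closed_closure.
have [M M0 gM] : exists2 M, 0 <= M & forall v, closure X v -> `|g v| <= M.
  pose K := [set v : state | forall i, `[- r, r]%classic (v ord0 i)] `&`
    closure X.
  have cK : compact K.
    apply: compact_closedI; last exact: closed_closure.
    apply: (@rV_compact R n (fun=> `[- r, r]%classic)) => _.
    exact: segment_compact.
  have /compact_bounded[M [_ KM]] : compact (g @` K).
    by apply: continuous_compact cK; apply: continuous_subspaceW cg;
      exact: subIsetr.
  exists (`|M| + 1) => [|v Xv]; first by rewrite addr_ge0.
  have [rv|/ltW vr] := leP r (enorm v); first by rewrite g0// normr0 addr_ge0.
  apply: (KM (`|M| + 1)); first by rewrite ltr_pwDr// ler_norm.
  exists v => //; split=> // i; rewrite /= in_itv/= -ler_norml.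
  exact: le_trans (coord_le_enorm v i) vr.
have volC : (vol cyl < +oo)%E := volume_cylinder_lty d T.
have mgu k : measurable_fun cyl (fun p => g (u k p)).
  have [mu Xu] := u_range k.
  apply: (@measurable_comp _ _ _ _ _ _ (closure X) g) => //.
  by move=> _ [p Cp <-]; exact: Xu.
have mav : measurable_fun cyl (average X nu (fun=> g)).
  apply: measurable_average.
  apply: (@measurable_comp _ _ _ _ _ _ (closure X) g) => //.
  - by move=> _ [[p v] [_ Xv] <-].
  - by apply: measurable_funTS; exact: measurable_snd.
have nuX p : (nu p (closure X) <= 1)%E.
  by apply: le_trans (sprob_kernel_le1 nu p); apply: le_measure; rewrite ?inE.
have inu p : (nu p).-integrable (closure X) (EFin \o g).
  apply: measurable_bounded_integrable => //.
    by apply: le_lt_trans (nuX p) _; rewrite ltry.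
  by exists M; split=> [|K MK v Xv];
    [exact: num_real|exact: le_trans (gM _ Xv) (ltW MK)].
split.
- move=> k; apply: measurable_bounded_integrable => //.
  exists M; split=> [|K MK p Cp]; first exact: num_real.
  by apply: le_trans (ltW MK); apply: gM; have [_] := u_range k; apply.
- split; first by apply: aeW => p _; exact: inu.
  apply: measurable_bounded_integrable => //.
  exists M; split=> [|K MK p Cp]; first exact: num_real.
  apply: le_trans (ltW MK); rewrite /average.
  apply: (le_trans (le_normr_Rintegral mX (inu p))).
  have iM : (nu p).-integrable (closure X) (EFin \o cst M).
    apply: measurable_bounded_integrable => //.
      by apply: le_lt_trans (nuX p) _; rewrite ltry.
    exact: bounded_cst.
  apply: (@le_trans _ _ (\int[nu p]_(v in closure X) M)).
    by apply: le_Rintegral => //; exact: integrable_norm.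
  rewrite Rintegral_cst// ler_piMr//.
  rewrite -lee_fin fineK//.
  by rewrite ge0_fin_numE// (le_lt_trans (nuX p))// ltry.
move=> phi cphi; rewrite addr0; apply: young => //.
  move=> e e0; exists r => v Xv rv; rewrite g0// normr0; exact: ltW.
apply: measurable_bounded_integrable => //; first exact: measurable_phi.
exact: bounded_phi.
Qed.

(** Let f be the combination.  For each r the product of f with [cutoff r] lies
    below f and has no defect.  In the limit along the sequence, the integral of
    phi times the average of the truncation is at most that of phi times the
    average of f, plus the defect.  Letting r tend to infinity cancels the two
    averages and leaves the defect. *)
Lemma defect_ge0 (J : finType) (h : J -> point -> R) (g : J -> state -> R)
    (L : J -> (point -> R) -> R) :
  (forall j, continuous_cylinder T (h j)) ->
  (forall j, {within closure X, continuous (g j)}) ->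
  (forall j, converges_with_defect (fun=> g j) (L j)) ->
  (forall p v, cyl p -> closure X v -> 0 <= \sum_j h j p * g j v) ->
  forall phi : point -> R, continuous_cylinder T phi ->
    (forall p, 0 <= phi p) ->
    0 <= \sum_j L j (fun p => phi p * h j p).
Proof.
move=> ch cg cvg f_ge0 phi cphi phi0.
have mg j : measurable_fun (closure X) (g j).
  by apply: continuous_closed_measurable => //; exact: closed_closure.
pose f p v := \sum_j h j p * g j v.
pose fr (r : nat) p v := \sum_j h j p * (cutoff r%:R v * g j v).
have frE r p v : fr r p v = cutoff r%:R v * f p v.
  by rewrite /fr /f mulr_sumr; apply: eq_bigr => j _; rewrite mulrCA.
have mcut (r : nat) : measurable_fun (closure X) (cutoff r%:R : state -> R).
  apply: continuous_closed_measurable; first exact: closed_closure.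
  by apply: continuous_subspaceT; exact: cutoff_continuous.
have convf : converges_with_defect f (fun phi =>
  \sum_j L j (fun p => phi p * h j p)).
  exact: converges_with_defect_lincomb.
have convfr r : converges_with_defect (fr r) (fun=> \sum_(j : J) 0).
  apply: (converges_with_defect_lincomb ch (L := fun _ _ => 0)
    (g := fun j v => cutoff r%:R v * g j v)) => j.
    exact: measurable_funM.
  apply: (@compact_support_no_defect _ (r%:R + 1)).
    move=> v; apply: continuousM; last exact: cg.
    by apply: continuous_subspaceT; exact: cutoff_continuous.
  by move=> v _ rv; rewrite cutoff0// mul0r.
have [if_ [aef iavf] limf] := convf.
have truncated_le r : \int[vol]_(p in cyl) (phi p * average X nu (fr r) p) <=
    \int[vol]_(p in cyl) (phi p * average X nu f p) +
    \sum_j L j (fun p => phi p * h j p).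
  have [ifr _ limfr] := convfr r.
  have := limfr _ cphi; rewrite big1// addr0 => {}limfr.
  apply: (ler_cvg_to limfr (limf _ cphi)); apply: nearW => k.
  apply: le_Rintegral => //; [|
    |].
  - by apply: (@integrable_phi phi (fun p => fr r p (u k p))) => //; exact: ifr.
  - by apply: (@integrable_phi phi (fun p => f p (u k p))) => //; exact: if_.
  move=> p Cp; rewrite ler_wpM2l// frE ler_piMl//; last exact: cutoff_le1.
  by apply: f_ge0 => //; have [_] := u_range k; apply.
have aefr_le : {ae vol, forall p (r : nat), cyl p ->
    0 <= average X nu (fr r) p <= average X nu f p}.
  apply: filterS aef => p iff r Cp; apply/andP; split.
    apply: Rintegral_ge0 => v Xv; rewrite frE mulr_ge0 ?cutoff_ge0//.
    exact: f_ge0.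
  apply: le_Rintegral => //; [|exact: iff|].
    apply: (le_integrable mX _ _ (iff Cp)).
      apply/measurable_EFinP/measurable_sum => j; apply: measurable_funM => //.
      exact: measurable_funM.
    move=> v Xv; rewrite /= lee_fin frE normrM ler_piMl//.
    by rewrite ger0_norm ?cutoff_le1// cutoff_ge0.
  move=> v Xv; rewrite frE ler_piMl ?cutoff_le1//; exact: f_ge0.
have aefr_cvg : {ae vol, forall p, cyl p ->
    average X nu (fr r) p @[r --> \oo] --> average X nu f p}.
  apply: filterS aef => p iff Cp.
  apply: (@Rintegral_dominated_cvg _ _ _ _ _ _ _ _ (f p)) => //.
  - move=> r; apply/measurable_sum => j; apply: measurable_funM => //.
    exact: measurable_funM.
  - by apply/measurable_sum => j; exact: measurable_funM.
  - apply: aeW => v Xv; apply: cvg_near_cst.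
    exists (Num.truncn (enorm v)).+1 => // r /= vr.
    rewrite frE cutoff1 ?mul1r//; apply: (le_trans (ltW (truncnS_gt _))).
    by rewrite ler_nat.
  - exact: iff.
  - apply: aeW => v r Xv; have fpv : 0 <= f p v by exact: f_ge0.
    by rewrite frE normrM !ger0_norm ?cutoff_ge0// ler_piMl// cutoff_le1.
have mphi := measurable_phi cphi.
have avm f' : vol.-integrable cyl (EFin \o average X nu f') ->
    measurable_fun cyl (average X nu f').
  by move=> i; apply/measurable_EFinP; exact: measurable_int i.
have lim_fr : \int[vol]_(p in cyl) (phi p * average X nu (fr r) p) @[r -->
  \oo] -->
    \int[vol]_(p in cyl) (phi p * average X nu f p).
  apply: (@Rintegral_dominated_cvg _ _ _ _ _ _ _ _
    (fun p => phi p * average X nu f p)) => //.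
  - by move=> r; apply: measurable_funM => //; apply: avm;
      have [_ []] := convfr r.
  - by apply: measurable_funM => //; exact: avm.
  - apply: filterS aefr_cvg => p + Cp => /(_ Cp) lim.
    by apply: cvgM => //; exact: cvg_cst.
  - exact: integrable_phi.
  - apply: filterS aefr_le => p + r Cp => /(_ r Cp)/andP[fr0 frf].
    by rewrite normrM (ger0_norm (phi0 p)) (ger0_norm fr0) ler_wpM2l.
have := cvgr_to_le lim_fr (nearW _ truncated_le).
rewrite lerDl; apply.
Qed.

End linear_combinations.

(** * Concentration measures of combinations *)

Section concentration_combination.
Context {R : realType} (d n : nat) (T : R).
Local Notation point := (R * 'rV[R]_d)%type.
Local Notation state := 'rV[R]_n.
Local Notation cyl := (cylinder T : set point).
Local Notation vol := (volume d : {measure set point -> \bar R}).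
Variables (X : set state) (nu : R.-pker point ~> state) (u : nat -> point ->
  state).
Hypothesis u_range : forall k, measurable_fun cyl (u k) /\
  forall p, cyl p -> closure X (u k p).
Hypothesis young : young_measure T X u nu.

Let mcyl : measurable cyl := measurable_cylinder T.

Lemma charge_integral_czero (D : set point) (phi : point -> R) :
  measurable D -> measurable_fun D phi -> [bounded phi p | p in D] ->
  charge_integral (czero : {charge set point -> \bar R}) D phi = 0.
Proof.
move=> mD mphi bphi.
rewrite (@charge_integral_density _ _ _ czero mzero (cst 0)) //.
- under eq_Rintegral do rewrite mulr0.
  by rewrite Rintegral_cst// mul0r.
- exact: integrable0.
- by move=> E mE; rewrite integral0_eq.
Qed.

(** For almost every p the measure [nu p] has mass 1 on the closure of X, so
    that the average of a constant is that constant; this makes affine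
    combinations instances of linear ones. *)
Lemma concentration_one : valued_in X vol cyl nu ->
  concentration T X u nu (fun _ _ => 1) czero.
Proof.
move=> nuX.
have mX : measurable (closure X) by apply: closed_measurable_rV;
  exact: closed_closure.
have volC : (vol cyl < +oo)%E := volume_cylinder_lty d T.
have one : {ae vol, forall p, cyl p -> average X nu (fun _ _ => 1) p = 1}.
  by apply: filterS nuX => p nu1 Cp;
    rewrite /average Rintegral_cst// nu1//= mul1r.
have mav : measurable_fun cyl (average X nu (fun _ _ => 1)).
  exact: measurable_average.
have i1 : vol.-integrable cyl (EFin \o cst (1 : R)).
  apply: measurable_bounded_integrable => //; exact: bounded_cst.
split.
- by move=> k; exact: i1.
- split; last exact: ae_integrable one.
  apply: filterS nuX => p nu1 Cp; apply: measurable_bounded_integrable => //.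
    by rewrite nu1// ltry.
  exact: bounded_cst.
move=> phi [cphi _].
have mphi := continuous_strip_measurable cphi.
rewrite charge_integral_czero//; last exact: continuous_strip_bounded.
rewrite addr0; apply: cvg_near_cst; apply: nearW => k.
apply: ae_eq_Rintegral => //.
- by under eq_fun do rewrite mulr1.
- exact: measurable_funM.
- by apply: filterS one => p + Cp => ->.
Qed.

(** With respect to a common reference measure, m' has the density obtained by
    combining the densities of the [m j] with the coefficients [h j], cut off
    outside of the cylinder. *)
Lemma concentration_lincomb (J : finType) (h : J -> point -> R)
    (g : J -> state -> R) (m : J -> {charge set point -> \bar R}) :
  (forall j, continuous_cylinder T (h j)) ->
  (forall j, {within closure X, continuous (g j)}) ->
  (forall j, concentration T X u nu (fun=> g j) (m j)) ->
  exists m' : {charge set point -> \bar R},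
    [/\ concentration T X u nu (fun p v => \sum_j h j p * g j v) m',
        forall E, measurable E -> E `<=` cyl ->
          m' E = (\sum_j charge_integral (m j) E (h j))%:E
      & (forall p v, cyl p -> closure X v -> 0 <= \sum_j h j p * g j v) ->
        forall E, measurable E -> E `<=` cyl -> (0 <= m' E)%E].
Proof.
move=> ch cg cm.
have mg j : measurable_fun (closure X) (g j).
  by apply: continuous_closed_measurable => //; exact: closed_closure.
have mh j : measurable_fun cyl (h j).
  by have [? _] := ch j; exact: continuous_strip_measurable.
have bh j : [bounded h j p | p in cyl].
  by have [? _] := ch j; exact: continuous_strip_bounded.
have [mu [w mw]] := charges_have_densities m.
have iw j : mu.-integrable setT (EFin \o w j) by have [] := mw j.
have mE j := (mw j).2.
have ihw j : mu.-integrable cyl (fun p => (h j p * w j p)%:E).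
  by apply: integrable_bounded_mul => //; exact: integrableS (iw j).
pose w' := (fun p => \sum_j h j p * w j p) \_ cyl.
have iw' : mu.-integrable setT (EFin \o w').
  rewrite /w' -restrict_EFin; apply/(integrable_mkcond _ mcyl).
  exact: integrable_Rsum.
have [m' m'E] := charge_of_density iw'.
have pairing (phi : point -> R) : continuous_cylinder T phi ->
    charge_integral m' cyl phi =
    \sum_j charge_integral (m j) cyl (fun p => phi p * h j p).
  move=> [cphi _]; have mphi := continuous_strip_measurable cphi.
  have bphi := continuous_strip_bounded cphi.
  rewrite (charge_integral_density iw' m'E)//.
  under [RHS]eq_bigr => j _.
    rewrite (charge_integral_density (iw j) (mE j))//; first last.
    - exact: bounded_mul.
    - exact: measurable_funM.
    under eq_Rintegral do rewrite -mulrA.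
    over.
  rewrite -Rintegral_sum//; last first.
    by move=> j; apply: integrable_bounded_mul => //; exact: ihw.
  apply: eq_Rintegral => p Cp; rewrite /w' patchE Cp mulr_sumr.
  by [].
exists m'; split.
- have [i av cv] := converges_with_defect_lincomb ch mg cm.
  by split=> // phi cphi; rewrite pairing//; exact: cv.
- move=> E mE' EC; rewrite m'E//.
  have mS j : measurable_fun E (h j) by exact: measurable_funS (mh j).
  have bS j : [bounded h j p | p in E].
    by have [M [Mr hM]] := bh j; exists M; split=> // r Mr' p /EC; exact: hM.
  under eq_bigr => j _ do rewrite (charge_integral_density (iw j) (mE j))//.
  have ihE j : mu.-integrable E (fun p => (h j p * w j p)%:E).
    exact: integrableS (ihw j).
  rewrite -Rintegral_sum// /Rintegral fineK.
    apply: eq_integral => p /set_mem Ep; rewrite /w' patchE mem_set//.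
    exact: EC.
  by apply: integrable_fin_num => //; exact: integrable_Rsum.
- move=> f_ge0; apply: charge_ge0_cylinder => phi cphi phi0.
  by rewrite pairing//; exact: (defect_ge0 u_range young ch cg cm).
Qed.

End concentration_combination.

(** * Total variation of a vector charge *)

Section total_variation.
Context disp (S : measurableType disp) (R : realType).

(** The bounds on the pieces of a partition add up by countable additivity of
    [lam]. *)
Lemma charge_total_variation_le (n : nat) (m : 'I_n -> {charge set S -> \bar R})
    (lam : {charge set S -> \bar R}) (C : R) (D : set S) : 0 <= C ->
  (forall E, measurable E -> E `<=` D ->
    (enorm (\row_i fine (m i E)))%:E <= C%:E * lam E)%E ->
  (forall E, measurable E -> E `<=` D -> (0 <= lam E)%E) ->
  forall E, measurable E -> E `<=` D ->
    (charge_total_variation m E <= C%:E * lam E)%E.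
Proof.
move=> C0 mlam lam0 E mE ED; apply: ge_ereal_sup => _ [P [mP tP PE] <-].
have PD k : P k `<=` D by move=> x Pkx; apply: ED; rewrite -PE; exists k.
apply: (@le_trans _ _ (\sum_(0 <= k <oo) (C%:E * lam (P k)))%E).
  apply: lee_nneseries => [k _ _|k _]; first by rewrite lee_fin sqrtr_ge0.
  exact: mlam.
rewrite nneseriesZl; last by move=> k _; exact: lam0.
rewrite lee_wpmul2l ?lee_fin// le_eqVlt; apply/orP; left; apply/eqP.
apply/cvg_lim => //; rewrite -PE; apply: charge_semi_sigma_additive => //.
by rewrite PE.
Qed.

End total_variation.

(** * Relative entropy and relative flux *)

Section coefficients.
Context {R : realType} (d n : nat) (T : R).
Local Notation point := (R * 'rV[R]_d)%type.
Local Notation state := 'rV[R]_n.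
Variables (X : set state) (U : point -> state).
Hypotheses (cU : continuous_cylinder T U) (UX : forall p, strip T p -> X (U p)).

Lemma continuous_cylinder_Ck (f : state -> state) k i : Ck k X f -> (0 < k)%N ->
  continuous_cylinder T (fun p => f (U p) ord0 i).
Proof.
case: k => // k [df _] _.
apply: (@continuous_cylinder_comp _ _ _ _ _ X U (fun v => f v ord0 i)) => //.
move=> v Xv; apply: (@continuous_comp _ _ _ f (fun w : state => w ord0 i)).
  exact/differentiable_continuous/df.
exact: coord_continuous.
Qed.

(** On X the entries of the Jacobian matrix are components of directional
    derivatives of [f], which are themselves differentiable. *)
Lemma continuous_cylinder_jacobian (f : state -> state) i j : Ck 2 X f ->
  continuous_cylinder T (fun p => 'J f (U p) i j).
Proof.
move=> [df cdf].
apply: (@eq_continuous_cylinder _ _ _ _ (fun p =>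
  'D_(delta_mx ord0 i) f (U p) ord0 j)).
  by move=> p /UX Xp; rewrite deriveE ?/jacobian ?mxE//; exact: df.
exact: (@continuous_cylinder_Ck _ 1 j (cdf (delta_mx ord0 i)) isT).
Qed.

Lemma continuous_cylinder_flux_matrix (A : state -> state)
    (F : 'I_d -> state -> state) a i j :
  Ck 2 X A -> Ck 2 X (F a) -> nonsingular X A ->
  continuous_cylinder T (fun p => flux_matrix A F a (U p) i j).
Proof.
move=> cA cF nA; rewrite /flux_matrix; under eq_fun do rewrite mxE.
apply: continuous_cylinder_sum => k; apply: continuous_cylinderM.
  apply: continuous_cylinder_invmx; first by move=> p /UX; exact: nA.
  by move=> b c; exact: continuous_cylinder_jacobian.
exact: continuous_cylinder_jacobian.
Qed.

End coefficients.

Section relative_quantities.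
Context {R : realType} (d n : nat).
Local Notation point := (R * 'rV[R]_d)%type.
Local Notation state := 'rV[R]_n.
Local Notation term := (bool + ('I_n + 'I_n))%type.
Variables (A : state -> state) (F : 'I_d -> state -> state) (eta : state -> R).
Variables (G : state -> state) (U : point -> state) (a : 'I_d).

Lemma sum_term (f : term -> R) : \sum_j f j =
  f (inl true) + f (inl false) + \sum_i f (inr (inl i)) + \sum_i f
    (inr (inr i)).
Proof. by rewrite !big_sumType/= big_bool addrA. Qed.

(** Relative entropy and relative flux are combinations of these functions with
    coefficients that depend on the point only.  Sharing one index type lets
    the two be combined in the bound on the flux. *)
Definition constituent (j : term) : state -> R :=
  match j with
  | inl true => fun=> 1
  | inl false => eta
  | inr (inl i) => fun v => A v ord0 i
  | inr (inr i) => fun v => F a v ord0 i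
  end.

Definition constituent_charge (mA mF : 'I_n -> {charge set point -> \bar R})
    (m_eta : {charge set point -> \bar R}) (j : term) :
    {charge set point -> \bar R} :=
  match j with
  | inl true => czero
  | inl false => m_eta
  | inr (inl i) => mA i
  | inr (inr i) => mF i
  end.

(** Minus signs are written as factors -1 to match [charge_integralZ]. *)
Definition entropy_coef (j : term) : point -> R :=
  match j with
  | inl true => fun p => dot (G (U p)) (A (U p)) - eta (U p)
  | inl false => fun=> 1
  | inr (inl i) => fun p => -1 * G (U p) ord0 i
  | inr (inr _) => fun=> 0
  end.

Definition flux_coef (i : 'I_n) (j : term) : point -> R :=
  match j with
  | inl true => fun p =>
      (A (U p) *m flux_matrix A F a (U p)) ord0 i - F a (U p) ord0 i
  | inl false => fun=> 0
  | inr (inl k) => fun p => -1 * flux_matrix A F a (U p) k i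
  | inr (inr k) => fun=> (k == i)%:R
  end.

Lemma relative_entropyE p v : relative_entropy A eta G v (U p) =
  \sum_j entropy_coef j p * constituent j v.
Proof.
rewrite sum_term /= mulr1 mul1r [X in _ + X]big1 ?addr0; last first.
  by move=> i _; rewrite mul0r.
rewrite /relative_entropy /dot (eq_bigr (fun i =>
    G (U p) ord0 i * A v ord0 i - G (U p) ord0 i * A (U p) ord0 i)); last first.
  by move=> i _; rewrite !mxE mulrBr.
rewrite [X in _ = _ + X](eq_bigr (fun i => - (G (U p) ord0 i * A v ord0 i)));
  last first.
  by move=> i _; rewrite mulN1r mulNr.
by rewrite sumrB sumrN; ring.
Qed.

Lemma relative_fluxE i p v : relative_flux A F a v (U p) ord0 i =
  \sum_j flux_coef i j p * constituent j v.
Proof.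
rewrite sum_term /= mulr1 mul0r addr0.
rewrite [X in _ + _ + X](bigD1 i)//= eqxx mul1r [X in _ + (_ + X)]big1 ?addr0;
  last first.
  by move=> k /negbTE ->; rewrite mul0r.
rewrite /relative_flux mulmxBl !mxE.
under [X in _ = _ - _ + X + _]eq_bigr do rewrite mulN1r mulNr mulrC.
by rewrite sumrN; ring.
Qed.

End relative_quantities.

Theorem proposition1p6 (R : realType) (d n : nat) (hd : (0 < d)%N) (hn : (0 < n)%N)
  (T : R) (hT : 0 < T)
  (X : set 'rV[R]_n) (hXo : open X) (hXc : convex_domain X)
  (A : 'rV[R]_n -> 'rV[R]_n) (F : 'I_d -> 'rV[R]_n -> 'rV[R]_n)
  (eta : 'rV[R]_n -> R) (q : 'I_d -> 'rV[R]_n -> R) (G : 'rV[R]_n -> 'rV[R]_n)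
  (hA : C2_cont X A) (hF : forall a, C2_cont X (F a))
  (U : R * 'rV[R]_d -> 'rV[R]_n) (hU : strong_solution T X A F U)
  (h1 : nonsingular X A)
  (h2 : entropy_law X A F eta q G)
  (h3 : convex_entropy X A eta G)
  (h4 : entropy_growth X A F eta)
  (h5 : relative_flux_bound T X A F eta G U)
  (nu : R.-pker (R * 'rV[R]_d)%type ~> 'rV[R]_n)
  (mA : 'I_n -> {charge set (R * 'rV[R]_d)%type -> \bar R})
  (mF : 'I_d -> 'I_n -> {charge set (R * 'rV[R]_d)%type -> \bar R})
  (m_eta : {finite_measure set (R * 'rV[R]_d)%type -> \bar R})
  (nu0 : R.-pker 'rV[R]_d ~> 'rV[R]_n)
  (mA0 : 'I_n -> {charge set 'rV[R]_d -> \bar R})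
  (m_eta0 : {finite_measure set 'rV[R]_d -> \bar R})
  (hsol : dissipative_mv_solution T X A F eta nu mA mF m_eta nu0 mA0 m_eta0)
  (u : nat -> R * 'rV[R]_d -> 'rV[R]_n)
  (P : nat -> (R * 'rV[R]_d -> 'rV[R]_n) -> R)
  (S : nat -> (R * 'rV[R]_d -> R) -> R)
  (hgen : generated_by T X A F eta q nu mA mF m_eta u P S) :
  exists m_rel : {charge set (R * 'rV[R]_d)%type -> \bar R},
    [/\ concentration T X u nu
          (fun p v => relative_entropy A eta G v (U p)) m_rel,
        forall E, measurable E -> E `<=` cylinder T ->
          m_rel E =
          (m_eta E - (charge_pairing mA E (fun p => G (U p)))%:E)%E,
        forall E, measurable E -> E `<=` cylinder T -> (0 <= m_rel E)%E
      & forall a : 'I_d,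
        exists m_flux : 'I_n -> {charge set (R * 'rV[R]_d)%type -> \bar R},
          [/\ forall i, concentration T X u nu
                (fun p v => relative_flux A F a v (U p) ord0 i) (m_flux i),
              forall i E, measurable E -> E `<=` cylinder T ->
                m_flux i E =
                (mF a i E - (\sum_j charge_integral (mA j) E
                   (fun p => flux_matrix A F a (U p) j i))%:E)%E
            & exists C : R, forall E, measurable E -> E `<=` cylinder T ->
                (charge_total_variation m_flux E <= C%:E * m_rel E)%E]].
Proof.
have [cU _ [K [_ KX KU]] _] := hU.
have [[u_range _ _ _ _] [concA concF conc_eta] _ young] := hgen.
have [[nuX _] _ _ _ _] := hsol.
have [[eta_cont C2eta] _ _ C1G _] := h2.
have [A_cont C2A] := hA.
have UX p : strip T p -> X (U p).
  have [_ pU] := cU; apply: (@strip_periodic_range _ _ _ _ U X pU) => p' Cp'.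
  exact/KX/KU.
have cG i := continuous_cylinder_Ck cU UX i C1G isT.
have cA i := continuous_cylinder_Ck cU UX i C2A isT.
have cF a i := continuous_cylinder_Ck cU UX i (hF a).2 isT.
have ceta : continuous_cylinder T (fun p => eta (U p)).
  apply: (@continuous_cylinder_comp _ _ _ _ _ X U eta) => // v Xv.
  exact/differentiable_continuous/C2eta.1.
have cM a i j : continuous_cylinder T (fun p => flux_matrix A F a (U p) i j).
  by have [_ C2F] := hF a;
    apply: (continuous_cylinder_flux_matrix cU UX i j C2A C2F h1).
have crel j : continuous_cylinder T (entropy_coef A eta G U j).
  case: j => [[]|[i|i]] /=; try exact: continuous_cylinder_cst.
    apply: continuous_cylinderD; last exact: continuous_cylinderN.
    by apply: continuous_cylinder_sum => i; exact: continuous_cylinderM.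
  by apply: continuous_cylinderM => //; exact: continuous_cylinder_cst.
have cflux a i j : continuous_cylinder T (flux_coef A F U a i j).
  case: j => [[]|[k|k]] /=; try exact: continuous_cylinder_cst.
    apply: continuous_cylinderD; last exact: continuous_cylinderN.
    under eq_fun do rewrite mxE.
    by apply: continuous_cylinder_sum => k; exact: continuous_cylinderM.
  by apply: continuous_cylinderM => //; exact: continuous_cylinder_cst.
have gen_cont a j : {within closure X, continuous (constituent A F eta a j)}.
  case: j => [[]|[i|i]] //=; first exact: cst_continuous.
    by move=> v; apply: (@continuous_comp (subspace (closure X)) _ _ A
      (fun w : 'rV[R]_n => w ord0 i)); [exact: A_cont|exact: coord_continuous].
  by move=> v; apply: (@continuous_comp (subspace (closure X)) _ _ (F a)
      (fun w : 'rV[R]_n => w ord0 i));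
        [exact: (hF a).1|exact: coord_continuous].
pose gen_charge a :=
  constituent_charge mA (mF a) (charge_of_finite_measure m_eta).
have gen_conc a j :
    concentration T X u nu (fun=> constituent A F eta a j) (gen_charge a j).
  case: j => [[]|[i|i]] /=.
  - exact: concentration_one.
  - exact: conc_eta.
  - exact: concA.
  - exact: concF.
have combination a h ch := concentration_lincomb u_range young
  (h := h) ch (gen_cont a) (gen_conc a).
pose rel_value E := fine (m_eta E) - charge_pairing mA E (fun p => G (U p)).
have rel_valueE a E : measurable E -> E `<=` cylinder T ->
    \sum_j charge_integral (gen_charge a j) E (entropy_coef A eta G U j) =
    rel_value E.
  move=> mE EC; rewrite sum_term /= charge_integral_czero//; last 2 first.
  - exact: continuous_cylinder_measurableS EC _ (crel (inl true)).
  - exact: continuous_cylinder_boundedS EC _ (crel (inl true)).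
  rewrite add0r charge_integral_cst// mul1r [X in _ + X]big1 ?addr0; last first.
    by move=> i _; rewrite charge_integral_cst// mul0r.
  rewrite /rel_value /charge_pairing; congr (_ + _); rewrite -sumrN.
  apply: eq_bigr => i _; rewrite (charge_integralZ mE EC)//.
  by rewrite mulN1r.
pose flux_value a i E := fine (mF a i E) - \sum_j charge_integral (mA j) E
  (fun p => flux_matrix A F a (U p) j i).
have flux_valueE a i E : measurable E -> E `<=` cylinder T ->
    \sum_j charge_integral (gen_charge a j) E (flux_coef A F U a i j) =
    flux_value a i E.
  move=> mE EC; rewrite sum_term /= charge_integral_czero//; last 2 first.
  - exact: continuous_cylinder_measurableS EC _ (cflux a i (inl true)).
  - exact: continuous_cylinder_boundedS EC _ (cflux a i (inl true)).
  rewrite add0r charge_integral_cst// mul0r add0r addrC.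
  rewrite /flux_value; congr (_ + _).
    rewrite (bigD1 i)//= charge_integral_cst// eqxx mul1r big1 ?addr0//.
    by move=> k /negbTE ki; rewrite charge_integral_cst// ki mul0r.
  rewrite -sumrN; apply: eq_bigr => j _; rewrite (charge_integralZ mE EC)//.
  by rewrite mulN1r.
have [C C0 fluxC] := h5.
(* As d > 0 there is a relative flux, and the relative entropy dominates it. *)
have rel_ge0 p v : cylinder T p -> closure X v ->
    0 <= relative_entropy A eta G v (U p).
  move=> Cp Xv; rewrite -(pmulr_rge0 _ C0).
  by apply: le_trans (fluxC v p (Ordinal hd) Xv Cp); exact: sqrtr_ge0.
have [m_rel [conc_rel m_relE m_rel_ge0]] := combination (Ordinal hd) _ crel.
have {}m_relE E : measurable E -> E `<=` cylinder T ->
  m_rel E = (rel_value E)%:E.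
  by move=> mE EC; rewrite m_relE// rel_valueE.
have {}m_rel_ge0 E : measurable E -> E `<=` cylinder T -> (0 <= m_rel E)%E.
  apply: m_rel_ge0 => p v Cp Xv; rewrite -relative_entropyE; exact: rel_ge0.
exists m_rel; split => //.
- congr concentration : conc_rel; apply/funext => p; apply/funext => v.
  by rewrite -relative_entropyE.
- by move=> E mE EC; rewrite m_relE// EFinB fineK// fin_num_measure.
move=> a.
have /choice[m_flux m_fluxP] i := combination a _ (cflux a i).
have m_fluxE i E : measurable E -> E `<=` cylinder T ->
    m_flux i E = (flux_value a i E)%:E.
  by move=> mE EC; have [_ -> // _] := m_fluxP i; rewrite flux_valueE.
exists m_flux; split.
- move=> i; have [+ _ _] := m_fluxP i.
  congr concentration; apply/funext => p; apply/funext => v.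
  by rewrite -relative_fluxE.
- by move=> i E mE EC; rewrite m_fluxE// EFinB fineK// fin_num_measure.
exists C; apply: charge_total_variation_le => // [|E mE EC]; first exact: ltW.
rewrite m_relE// -EFinM lee_fin.
set x := \row_i _.
have xE i : x ord0 i = flux_value a i E by rewrite mxE m_fluxE.
have [x0|x0] := eqVneq (enorm x) 0.
  by rewrite x0 mulr_ge0 ?(ltW C0)// -lee_fin -m_relE// m_rel_ge0.
have x_gt0 : 0 < enorm x by rewrite lt_neqAle eq_sym x0 sqrtr_ge0.
(* The flux is tested against its own value x on E: the coefficients [h] are
   those of C |x| eta(.|U) - x . F_a(.|U). *)
pose h j p := (enorm x * C) * entropy_coef A eta G U j p +
  \sum_i (- x ord0 i) * flux_coef A F U a i j p.
have ch j : continuous_cylinder T (h j).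
  apply: continuous_cylinderD.
    by apply: continuous_cylinderM => //; exact: continuous_cylinder_cst.
  apply: continuous_cylinder_sum => i; apply: continuous_cylinderM => //.
  exact: continuous_cylinder_cst.
have [m' [_ /(_ E mE EC) m'E m'_ge0]] := combination a h ch.
have : (0 <= m' E)%E.
  apply: m'_ge0 => // p v Cp Xv.
  rewrite (_ : \sum_j _ = enorm x * C * relative_entropy A eta G v (U p) -
    dot x (relative_flux A F a v (U p))).
    rewrite subr_ge0 (le_trans (dot_le_enorm _ _))// -mulrA ler_wpM2l
      ?(ltW x_gt0)//.
    exact: fluxC.
  under eq_bigr do rewrite mulrDl -mulrA mulr_suml.
  rewrite big_split/= -mulr_sumr -relative_entropyE exchange_big/=;
    congr (_ + _).
  rewrite /dot -sumrN; apply: eq_bigr => i _.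
  by rewrite (relative_fluxE A F eta) -mulNr mulr_sumr; apply: eq_bigr => j _;
    rewrite mulrA.
rewrite m'E lee_fin.
have -> : \sum_j charge_integral (gen_charge a j) E (h j) =
    enorm x * C * rel_value E - dot x x.
  have hE j : charge_integral (gen_charge a j) E (h j) =
      enorm x * C * charge_integral (gen_charge a j) E
        (entropy_coef A eta G U j) +
      \sum_i (- x ord0 i) * charge_integral (gen_charge a j) E
        (flux_coef A F U a i j).
    (* The summand for the entropy gets the one-element index type 'I_1. *)
    pose c (o : 'I_1 + 'I_n) := if o is inr i then - x ord0 i else enorm x * C.
    pose k (o : 'I_1 + 'I_n) := if o is inr i then flux_coef A F U a i j
                                else entropy_coef A eta G U j.
    have ck o : continuous_cylinder T (k o).
      by case: o => [z|i]; [exact: crel|exact: cflux].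
    have := charge_integral_lincomb (gen_charge a j) mE c
      (fun o => continuous_cylinder_measurableS EC (ck o))
      (fun o => continuous_cylinder_boundedS EC (ck o)).
    rewrite big_sumType/= big_ord1 => <-; congr charge_integral;
      apply/funext => p.
    by rewrite big_sumType/= big_ord1.
  under eq_bigr do rewrite hE.
  rewrite big_split/= -mulr_sumr rel_valueE// exchange_big/=; congr (_ + _).
  rewrite /dot -sumrN; apply: eq_bigr => i _.
  by rewrite -mulr_sumr flux_valueE// xE mulNr.
by rewrite -sqr_enorm expr2 -mulrA -mulrBr pmulr_rge0// subr_ge0.
Qed.
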